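(* Let $n\ge 1$, $m=\lceil n/2\rceil$, and let $x,k_1,\ldots,k_m$ be integers with $k_1<\cdots<k_m\le x$. Let $\gamma(n,x;k_1,\ldots,k_m)$ be the number of halved monotone triangles with $n$ rows, bottom row $(k_1,\ldots,k_m)$ and no entry exceeding $x$. If $n$ is odd then $$\gamma(n,x;k_1,\ldots,k_m)=\left(\prod_{1\le p<q\le (n+1)/2}(\mathrm{id}+E_{k_q}\Delta_{k_p})^{-1}E_{k_p}(\mathrm{id}+E^{-1}_{k_q}\Delta_{k_p})^{-1}\right)\prod_{1\le i<j\le (n+1)/2}\frac{(k_j-k_i)(2x+1-k_i-k_j)}{(j-i)(j+i-1)},$$ and if $n$ is even then $$\gamma(n,x;k_1,\ldots,k_m)=\left(\prod_{1\le p<q\le n/2}(\mathrm{id}+E_{k_q}\Delta_{k_p})^{-1}E_{k_p}(\mathrm{id}+E^{-1}_{k_q}\Delta_{k_p})^{-1}\right)\prod_{1\le i<j\le n/2}\frac{(k_j-k_i)(2x+2-k_i-k_j)}{(j-i)(j+i)}\prod_{i=1}^{n/2}\frac{x+1-k_i}{i}.$$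
   Context: A halved monotone triangle with $n$ rows is a triangular array of integers $(a_{i,j})_{1\le i\le n,\,1\le j\le\lceil i/2\rceil}$ with $a_{i+1,j}\le a_{i,j}$, $a_{i,j}\le a_{i+1,j+1}$ and $a_{i,j}<a_{i,j+1}$ whenever the entries are defined; its bottom row is row $n$. $E_y p(y)=p(y+1)$ is the shift operator, $E_y^{-1}p(y)=p(y-1)$, and $\Delta_y=E_y-\mathrm{id}$ is the difference operator, acting on polynomials in $k_1,\ldots,k_m$ (with $x$ a parameter). The operators $\mathrm{id}+E_{k_q}\Delta_{k_p}$ and $\mathrm{id}+E^{-1}_{k_q}\Delta_{k_p}$ are of the form $P(\Delta_{k_1},\ldots,\Delta_{k_m})$ for a formal power series $P$ with constant term $1$ (using $E=\mathrm{id}+\Delta$, $E^{-1}=\sum_{r\ge0}(-\Delta)^r$), which acts on polynomials as a finite sum; such operators are invertible on the polynomial ring, the inverse being given by the inverse formal power series. Products of operators mean composition; the resulting polynomial is evaluated at the given integers. *)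

(* Defs.v *)
From HB Require Import structures.
From mathcomp Require Import all_boot all_order all_algebra.
From mathcomp Require Import finmap.
From mathcomp Require Import mathcomp_extra boolp classical_sets functions.
From mathcomp Require Import cardinality.
From mathcomp Require Import mpoly.
From mathcomp Require Import zify.

Set Implicit Arguments.
Unset Strict Implicit.
Unset Printing Implicit Defensive.

Import Order.TTheory GRing.Theory Num.Theory.
Local Open Scope ring_scope.
Local Open Scope classical_set_scope.

(** * Halved monotone triangles *)

(* Rows and columns are numbered from 0, so row [i] has
   [uphalf i.+1] = ceil((i+1)/2) entries. *)
Definition hmt_index (n : nat) : finType :=
  {ij : 'I_n * 'I_(uphalf n) | (ij.2 < uphalf ij.1.+1)%N}.

Definition hmt_row n (u : hmt_index n) : 'I_n := (val u).1.
Definition hmt_col n (u : hmt_index n) : 'I_(uphalf n) := (val u).2.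

Definition is_hmt n (a : {ffun hmt_index n -> int}) : Prop :=
  forall u v : hmt_index n,
  [/\ hmt_row v = (hmt_row u).+1 :> nat -> hmt_col v = hmt_col u :> nat ->
        a v <= a u,
      hmt_row v = (hmt_row u).+1 :> nat -> hmt_col v = (hmt_col u).+1 :> nat ->
        a u <= a v
    & hmt_row v = hmt_row u :> nat -> hmt_col v = (hmt_col u).+1 :> nat ->
        a u < a v].

Definition hmt_bottom n (a : {ffun hmt_index n -> int})
    (k : 'I_(uphalf n) -> int) : Prop :=
  forall u : hmt_index n, (hmt_row u).+1 = n -> a u = k (hmt_col u).

Definition hmt_set n (x : int) (k : 'I_(uphalf n) -> int) :
    set {ffun hmt_index n -> int} :=
  [set a | [/\ is_hmt a, hmt_bottom a k & forall u, a u <= x]].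

(* [fset_set] is meaningful only on finite sets; see [finite_hmt_set]. *)
Definition gamma n (x : int) (k : 'I_(uphalf n) -> int) : nat :=
  #|` fset_set (hmt_set x k)|%fset.

Lemma hmt_ge_bottom n (a : {ffun hmt_index n -> int}) k (u : hmt_index n) :
  is_hmt a -> hmt_bottom a k -> k (hmt_col u) <= a u.
Proof.
move=> Ha Hb; have [d Hd] : exists d, (n - (hmt_row u).+1)%N = d by exists (n - (hmt_row u).+1)%N.
elim: d u Hd => [|d IH] u Hd.
  by rewrite Hb //; have := ltn_ord (hmt_row u); lia.
have lt_u : ((hmt_row u).+1 < n)%N by lia.
have lt_c : (hmt_col u < uphalf (hmt_row u).+2)%N.
  by have := valP u; rewrite -/(hmt_row u) -/(hmt_col u); lia.
pose v : hmt_index n :=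
  @exist _ (fun ij : 'I_n * 'I_(uphalf n) => (ij.2 < uphalf ij.1.+1)%N)
    (Ordinal lt_u, hmt_col u) lt_c.
have [/(_ erefl erefl) le_vu _ _] := Ha u v.
by apply: le_trans le_vu; apply: (IH v); rewrite /=; lia.
Qed.

Lemma finite_hmt_set n (x : int) (k : 'I_(uphalf n) -> int) :
  finite_set (hmt_set x k).
Proof.
pose N := (\sum_j `|(x - k j)%R|)%N.
pose f (g : {ffun hmt_index n -> 'I_N.+1}) : {ffun hmt_index n -> int} :=
  [ffun u => k (hmt_col u) + (g u)%:Z].
apply: (@sub_finite_set _ _ (f @` setT)); last first.
  by apply: finite_image; apply: finite_finset.
move=> a [Ha Hb Hx].
exists [ffun u => inord `|(a u - k (hmt_col u))%R|%N] => //.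
apply/ffunP => u; rewrite !ffunE.
have ge0 := hmt_ge_bottom u Ha Hb; have le_x := Hx u.
have leN : (`|(x - k (hmt_col u))%R| <= N)%N.
  by rewrite /N (bigD1 (hmt_col u)) //= leq_addr.
by rewrite inordK; lia.
Qed.

(** * Operators on polynomials in [k_0, ..., k_(m-1)] *)

Section Operators.
Variable m : nat.
Implicit Types (i p q : 'I_m) (P : {mpoly rat[m]}).

(* P(..., k_i, ...) |-> P(..., k_i + c, ...) *)
Definition shift i (c : rat) P : {mpoly rat[m]} :=
  P \mPo [tuple 'X_j + (if j == i then c else 0)%:MP | j < m].

Definition E i := shift i 1.
Definition Einv i := shift i (-1).
Definition Delta i P : {mpoly rat[m]} := E i P - P.

(* The series 1/(1 + u) = sum_r (-u)^r, for an operator [u = A] that is a power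
   series without constant term in the [Delta i]. As each [Delta i] lowers the
   degree, [iter r A P] vanishes for [r >= msize P]; see [id_addK] and
   [id_add_invK] for the operators [id + E q Delta p], [id + Einv q Delta p]. *)
Definition id_add_inv (A : {mpoly rat[m]} -> {mpoly rat[m]}) P :=
  \sum_(r < msize P) (-1) ^+ r *: iter r A P.

Definition factor p q : {mpoly rat[m]} -> {mpoly rat[m]} :=
  id_add_inv (E q \o Delta p) \o E p \o id_add_inv (Einv q \o Delta p).

(* The factors commute, so the order of composition is irrelevant. *)
Definition factors : {mpoly rat[m]} -> {mpoly rat[m]} :=
  \big[comp/id]_(pq : 'I_m * 'I_m | (pq.1 < pq.2)%N) factor pq.1 pq.2.

Lemma shift_is_linear i c : linear (shift i c).
Proof. by move=> a P Q; rewrite /shift linearP. Qed.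
HB.instance Definition _ i c :=
  GRing.isLinear.Build rat {mpoly rat[m]} {mpoly rat[m]} _ (shift i c)
    (shift_is_linear i c).

Lemma Delta_is_linear i : linear (Delta i).
Proof.
by move=> a P Q; rewrite /Delta /E linearP opprD addrACA scalerBr.
Qed.
HB.instance Definition _ i :=
  GRing.isLinear.Build rat {mpoly rat[m]} {mpoly rat[m]} _ (Delta i)
    (Delta_is_linear i).

Lemma shiftM i c P Q : shift i c (P * Q) = shift i c P * shift i c Q.
Proof. by rewrite /shift rmorphM. Qed.

Lemma shiftXU i c j :
  shift i c 'X_j = 'X_j + (if j == i then c else 0)%:MP.
Proof. by rewrite /shift comp_mpolyXU -tnth_nth tnth_mktuple. Qed.

Lemma msize_shiftXU i c j : (msize (shift i c 'X_j) <= 2)%N.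
Proof.
rewrite shiftXU (leq_trans (msizeD_le _ _)) // geq_max msizeX mdeg1 /=.
by rewrite msizeC (leq_trans (leq_b1 _)).
Qed.

Lemma msize_mulW P Q (a b : nat) :
  (msize P <= a)%N -> (msize Q <= b.+1)%N -> (msize (P * Q) <= a + b)%N.
Proof.
move=> HP HQ; have [->|nzP] := eqVneq P 0; first by rewrite mul0r msize0.
have [->|nzQ] := eqVneq Q 0; first by rewrite mulr0 msize0.
by rewrite msizeM // -subn1 leq_subLR add1n -addnS leq_add.
Qed.

Lemma msize_linear_le (f : {linear {mpoly rat[m]} -> {mpoly rat[m]}}) (e : nat) :
  (forall u : 'X_{1..m}, (msize (f 'X_[u]) <= (mdeg u).+1 - e)%N) ->
  forall P, (msize (f P) <= msize P - e)%N.
Proof.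
move=> Hf P; rewrite {1}(mpolyE P) linear_sum /=.
rewrite (leq_trans (msize_sum _ _ _)) //; apply/bigmax_leqP_seq => u Pu _.
rewrite linearZ (leq_trans (msizeZ_le _ _)) // (leq_trans (Hf u)) //.
by rewrite leq_sub2r // msize_mdeg_lt.
Qed.

Lemma mnm_eq0_or (u : 'X_{1..m}) : u = 0%MM \/ exists j, u j != 0%N.
Proof.
have [/existsP|/existsPn nex] := boolP [exists j, u j != 0%N]; first by right.
by left; apply/mnmP => j; rewrite mnm0E; apply/eqP/negPn/nex.
Qed.

Lemma msize_shiftX i c (u : 'X_{1..m}) : (msize (shift i c 'X_[u]) <= (mdeg u).+1)%N.
Proof.
have [d] := ubnP (mdeg u); elim: d u => // d IH u ltd.
have [->|[j nz_uj]] := mnm_eq0_or u.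
  by rewrite mpolyX0 /shift rmorph1 msize1.
have lej : (U_(j) <= u)%MM by rewrite lep1mP.
move: ltd; rewrite -(submK lej) mpolyXD shiftM mdegD mdeg1 => ltd.
by rewrite -addSn msize_mulW ?msize_shiftXU // IH //; lia.
Qed.

Lemma msize_shift i c P : (msize (shift i c P) <= msize P)%N.
Proof.
by rewrite -[leqRHS]subn0; apply: msize_linear_le => u; rewrite subn0 msize_shiftX.
Qed.

Lemma msize_Delta i P : (msize (Delta i P) <= msize P - 1)%N.
Proof.
apply: msize_linear_le => u; rewrite subn1 /=.
have [d] := ubnP (mdeg u); elim: d u => // d IH u ltd.
have [->|[j nz_uj]] := mnm_eq0_or u.
  by rewrite mpolyX0 /Delta /E /shift rmorph1 subrr msize0.
have lej : (U_(j) <= u)%MM by rewrite lep1mP.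
move: ltd; rewrite -(submK lej) mpolyXD mdegD mdeg1; set v := (u - _)%MM => ltd.
have -> : Delta i ('X_[v] * 'X_j) =
    Delta i 'X_[v] * E i 'X_j + 'X_[v] * Delta i 'X_j.
  by rewrite /Delta /E shiftM mulrBl mulrBr addrA subrK.
rewrite (leq_trans (msizeD_le _ _)) // geq_max; apply/andP; split.
  by apply: msize_mulW; [apply: IH; lia | apply: msize_shiftXU].
rewrite addn1 -[X in (_ <= X)%N]addn0; apply: msize_mulW.
  by rewrite msizeX.
by rewrite /Delta /E shiftXU addrAC subrr add0r msizeC leq_b1.
Qed.

Section Inverse.
Variables (p q : 'I_m) (c : rat).
Let A := shift q c \o Delta p.

Lemma msize_iter_shift_Delta r P : (msize (iter r A P) <= msize P - r)%N.
Proof.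
elim: r => [|r IH] /=; first by rewrite subn0.
by rewrite (leq_trans (msize_shift _ _ _)) // (leq_trans (msize_Delta _ _)) //; lia.
Qed.

Lemma id_add_invE N P : (msize P <= N)%N ->
  id_add_inv A P = \sum_(r < N) (-1) ^+ r *: iter r A P.
Proof.
move=> leN; rewrite /id_add_inv -!(big_mkord xpredT (fun r => (-1) ^+ r *: iter r A P)).
rewrite [RHS](@big_cat_nat _ _ _ (msize P)) //= [X in _ = _ + X]big_nat [X in _ = _ + X]big1 ?addr0 // => r /andP[ler _].
have := msize_iter_shift_Delta r P.
have -> : (msize P - r = 0)%N by lia.
by rewrite leqn0 msize_poly_eq0 => /eqP->; rewrite scaler0.
Qed.

Lemma id_add_inv_telescope N P : (msize P <= N)%N ->
  \sum_(r < N) (-1) ^+ r *: (iter r A P + iter r.+1 A P) = P.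
Proof.
move=> leN.
transitivity (- \sum_(0 <= r < N) ((-1) ^+ r.+1 *: iter r.+1 A P - (-1) ^+ r *: iter r A P)).
  rewrite big_mkord -sumrN; apply: eq_bigr => r _.
  by rewrite opprB exprS mulN1r scaleNr opprK scalerDr.
rewrite telescope_sumr // opprB expr0 scale1r.
have := msize_iter_shift_Delta N P.
have -> : (msize P - N = 0)%N by lia.
by rewrite leqn0 msize_poly_eq0 => /eqP->; rewrite scaler0 subr0.
Qed.

Lemma id_add_invK P :
  let Q := id_add_inv (shift q c \o Delta p) P in
  Q + (shift q c \o Delta p) Q = P.
Proof.
rewrite /= -{3}(id_add_inv_telescope (leqnn (msize P))) /id_add_inv.
rewrite !linear_sum -big_split; apply: eq_bigr => r _ /=.
by rewrite !linearZ scalerDr.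
Qed.

Lemma id_addK P :
  id_add_inv (shift q c \o Delta p) (P + (shift q c \o Delta p) P) = P.
Proof.
rewrite (@id_add_invE (msize P)); last first.
  rewrite (leq_trans (msizeD_le _ _)) // geq_max leqnn /=.
  exact: leq_trans (msize_iter_shift_Delta 1 P) (leq_subr _ _).
rewrite -[RHS](id_add_inv_telescope (leqnn (msize P))); apply: eq_bigr => r _.
congr (_ *: _); elim: (r : nat) => [//|s IH].
by rewrite [LHS]iterS IH; exact: (linearD A).
Qed.

End Inverse.
End Operators.

(* Main.v *)
Require Import Defs.
From HB Require Import structures.
From mathcomp Require Import all_boot all_order all_algebra.
From mathcomp Require Import fingroup perm.
From mathcomp Require Import finmap.
From mathcomp Require Import boolp classical_sets cardinality.
From mathcomp Require Import mpoly ssrcomplements.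
From mathcomp Require Import ring zify.

(* For a polynomial [Q] let [M Q = factors Q], and let [B] be a function of
   [l_1, ..., l_(m-1)] such that [(id - E_(i+1) + E_i E_(i+1)) B] vanishes
   wherever [l_i = l_(i+1)]. Summing [Delta_1 ... Delta_(m-1) B] over the
   strictly increasing [l] with [k_i <= l_i <= k_(i+1)] then telescopes to
     \sum_t (-1)^t B(k_1, ..., k_t, k_(t+2) + 1, ..., k_m + 1),
   because the diagonal terms excluded by strictness cancel exactly the products
   in which some [k_i] is chosen twice. If [Q] is antisymmetric, [B = M Q] has
   this property: the operator [M] inverts
     \prod_(p < q) (id - E_q + E_p E_q) (E_p + E_q - id) E_p^-1 E_q^-1,
   which is symmetric in [k_i], [k_(i+1)] but for its factor
   [id - E_(i+1) + E_i E_(i+1)].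
   With [u = x + 1 - k], the two products of the statement are, up to sign,
   [det C(u_i + j - 1, 2 j)] and [det C(u_i + j, 2 j + 1)], and Pascal's rule
   relates their iterated differences.
   For [n] even, the sum is the one above with [k_(m+1) = x]. The factors of [M]
   are invariant under [E_m -> E_m^-1], so [M] commutes with the reflection
   [u_m -> - u_m] of the last variable; hence [B] vanishes when its last argument
   is [x + 1], and only one term of the telescoped sum survives.
   For [n] odd, the telescoped sum is the expansion of a determinant along its
   column of ones, because setting [E_t = id] in [M] leaves the operator on the
   other variables, up to a monomial shift. *)

Set Implicit Arguments.
Unset Strict Implicit.
Unset Printing Implicit Defensive.

Import Order.TTheory GRing.Theory Num.Theory.
Local Open Scope ring_scope.

(** * Shift operators on polynomials *)

Section Substitution.
Variables (n k : nat) (f : 'I_n -> {mpoly rat[k]}).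

Definition subst (P : {mpoly rat[n]}) : {mpoly rat[k]} :=
  P \mPo [tuple f i | i < n].

HB.instance Definition _ := GRing.LRMorphism.copy subst
  (comp_mpoly [tuple f i | i < n]).

Lemma substX i : subst 'X_i = f i.
Proof. by rewrite /subst comp_mpolyXU -tnth_nth tnth_mktuple. Qed.

Lemma substC c : subst c%:MP = c%:MP.
Proof. exact: comp_mpolyC. Qed.

Lemma subst_eval P v : (subst P).@[v] = P.@[fun i => (f i).@[v]].
Proof.
by rewrite comp_mpoly_meval; apply: meval_eq => i; rewrite tnth_mktuple.
Qed.

End Substitution.

Lemma mpoly_XU_ind n (K : {mpoly rat[n]} -> Prop) :
  (forall c, K c%:MP) -> (forall i, K 'X_i) ->
  (forall P Q, K P -> K Q -> K (P + Q)) ->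
  (forall P Q, K P -> K Q -> K (P * Q)) ->
  forall P, K P.
Proof.
move=> KC KX KD KM P; have K0 : K 0 by rewrite -[0]mpolyC0.
have K1 : K 1 by rewrite -mpolyC1.
rewrite (mpolyE P); apply: big_ind => // u _.
rewrite -mul_mpolyC; apply: (KM) => //; rewrite mpolyXE_id.
apply: big_ind => // i _; elim: (u i) => [|j IH]; first by rewrite expr0.
by rewrite exprS; apply: KM.
Qed.

Lemma eq_subst n k (f g : 'I_n -> {mpoly rat[k]}) :
  f =1 g -> subst f =1 subst g.
Proof. by move=> fg P; rewrite /subst (eq_mktuple _ fg). Qed.

Lemma subst_comp n k l (f : 'I_n -> {mpoly rat[k]})
  (g : 'I_k -> {mpoly rat[l]}) P :
  subst g (subst f P) = subst (fun i => subst g (f i)) P.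
Proof.
elim/mpoly_XU_ind: P => [c|i|P Q IHP IHQ|P Q IHP IHQ].
- by rewrite !substC.
- by rewrite !substX.
- by rewrite !rmorphD /= IHP IHQ.
- by rewrite !rmorphM /= IHP IHQ.
Qed.

Lemma subst_id n (P : {mpoly rat[n]}) : subst (fun i => 'X_i) P = P.
Proof. exact: comp_mpoly_id. Qed.

(** * Polynomials in the shifts, acting on polynomials *)

Section Action.
Variable m : nat.
Implicit Types (P Q R Phi Psi : {mpoly rat[m]}) (u v : 'X_{1..m}) (i j : 'I_m).

Definition shiftm u := subst (fun j => 'X_j + (u j)%:R%:MP : {mpoly rat[m]}).

HB.instance Definition _ u := GRing.LRMorphism.on (shiftm u).

Lemma shiftm0 P : shiftm 0%MM P = P.
Proof.
rewrite -[RHS]subst_id; apply: eq_subst => j.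
by rewrite mnm0E mpolyC0 addr0.
Qed.

Lemma shiftmD u v P : shiftm (u + v)%MM P = shiftm u (shiftm v P).
Proof.
rewrite [RHS]subst_comp; apply: eq_subst => j /=.
by rewrite rmorphD /= substX substC -addrA -mpolyCD mnmDE natrD.
Qed.

Lemma shiftmU i P : shiftm U_(i)%MM P = E i P.
Proof.
rewrite /E /shift /shiftm; apply: eq_subst => j.
by rewrite mnm1E eq_sym; case: eqP.
Qed.

(** The variable ['X_i] of [Phi] stands for the operator [E i], so that operator identities become
    identities in a commutative ring. Inverse shifts are avoided by clearing denominators. *)
Definition shift_op Phi P := \sum_(u <- msupp Phi) Phi@_u *: shiftm u P.

Lemma shift_op_is_linear Phi : linear (shift_op Phi).
Proof.
move=> a P Q; rewrite /shift_op scaler_sumr -big_split; apply: eq_bigr => u _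
  /=.
by rewrite linearP scalerDr !scalerA mulrC.
Qed.
HB.instance Definition _ Phi :=
  GRing.isLinear.Build rat {mpoly rat[m]} {mpoly rat[m]} _ (shift_op Phi)
    (shift_op_is_linear Phi).

(** An index set independent of the support makes additivity in [Phi] a termwise matter. *)
Lemma actwE d Phi P : (msize Phi <= d)%N ->
  shift_op Phi P = \sum_(u : 'X_{1..m < d}) Phi@_u *: shiftm u P.
Proof.
move=> led; rewrite /shift_op (big_mksub ('X_{1..m < d} : subFinType _))
  ?msupp_uniq //=; first last.
  by move=> u /msize_mdeg_lt /leq_trans; apply.
by rewrite big_rmcond //= => u /memN_msupp_eq0->; rewrite scale0r.
Qed.

Lemma shift_opDl Phi Psi P :
  shift_op (Phi + Psi) P = shift_op Phi P + shift_op Psi P.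
Proof.
pose d := maxn (msize Phi) (msize Psi).
rewrite !(@actwE d) ?leq_maxl ?leq_maxr ?msizeD_le // -big_split.
by apply: eq_bigr => u _; rewrite mcoeffD scalerDl.
Qed.

Lemma shift_opZl c Phi P : shift_op (c *: Phi) P = c *: shift_op Phi P.
Proof.
rewrite !(@actwE (msize Phi)) ?msizeZ_le // scaler_sumr.
by apply: eq_bigr => u _; rewrite mcoeffZ scalerA.
Qed.

Lemma shift_op_suml (I : Type) (r : seq I) (F : I -> {mpoly rat[m]}) P :
  shift_op (\sum_(i <- r) F i) P = \sum_(i <- r) shift_op (F i) P.
Proof.
elim: r => [|i r IH]; first by rewrite !big_nil /shift_op msupp0 big_nil.
by rewrite !big_cons shift_opDl IH.
Qed.

Lemma shift_opXm u P : shift_op 'X_[u] P = shiftm u P.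
Proof. by rewrite /shift_op msuppX big_seq1 mcoeffX eqxx scale1r. Qed.

Lemma shift_op1 P : shift_op 1 P = P.
Proof. by rewrite -mpolyX0 shift_opXm shiftm0. Qed.

Lemma shift_opC c P : shift_op c%:MP P = c *: P.
Proof. by rewrite -[c%:MP]mulr1 mul_mpolyC shift_opZl shift_op1. Qed.

Lemma shift_opX i P : shift_op 'X_i P = E i P.
Proof. by rewrite shift_opXm shiftmU. Qed.

Lemma shift_opBl Phi Psi P :
  shift_op (Phi - Psi) P = shift_op Phi P - shift_op Psi P.
Proof. by rewrite shift_opDl -scaleN1r shift_opZl scaleN1r. Qed.

Lemma shift_opM Phi Psi P :
  shift_op (Phi * Psi) P = shift_op Phi (shift_op Psi P).
Proof.
have shift_opXM u : shift_op ('X_[u] * Psi) P = shiftm u (shift_op Psi P).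
  rewrite {1}(mpolyE Psi) mulr_sumr shift_op_suml linear_sum; apply: eq_bigr =>
    v _.
  by rewrite -scalerAr shift_opZl -mpolyXD shift_opXm shiftmD linearZ.
rewrite {1}(mpolyE Phi) mulr_suml shift_op_suml; apply: eq_bigr => u _.
by rewrite -scalerAl shift_opZl shift_opXM.
Qed.

Lemma shift_op_comm Phi Psi P :
  shift_op Phi (shift_op Psi P) = shift_op Psi (shift_op Phi P).
Proof. by rewrite -!shift_opM mulrC. Qed.

Lemma shift_opXB1 i P : shift_op ('X_i - 1) P = Delta i P.
Proof. by rewrite shift_opBl shift_opX shift_op1. Qed.

Lemma msize_shiftmB u P : (msize (shiftm u P - P) <= msize P - 1)%N.
Proof.
have [d] := ubnP (mdeg u); elim: d u P => // d IH u P ltd.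
have [->|[j nz_uj]] := mnm_eq0_or u; first by rewrite shiftm0 subrr msize0.
have lej : (U_(j) <= u)%MM by rewrite lep1mP.
move: ltd; rewrite -(submK lej) mdegD mdeg1 shiftmD shiftmU; set v :=
  (u - _)%MM => ltd.
(* Peeling off one [E j], which is id + [Delta j], leaves two differences along the smaller exponent
   [v] and a single [Delta j]. *)
have -> : shiftm v (E j P) - P = (shiftm v (Delta j P) - Delta j P) + Delta j P
  + (shiftm v P - P).
  by rewrite subrK /Delta linearB /= addrA subrK.
have leD := msize_Delta j P.
rewrite (leq_trans (msizeD_le _ _)) // geq_max IH ?andbT; last by lia.
rewrite (leq_trans (msizeD_le _ _)) // geq_max leD andbT.
by apply: leq_trans (IH _ _ _) _; [lia | rewrite leq_sub2r // (leq_trans leD)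
  // leq_subr].
Qed.

Lemma mevalE1 Phi : Phi.@[fun=> 1] = \sum_(u <- msupp Phi) Phi@_u.
Proof.
rewrite mevalE; apply: eq_bigr => u _.
by rewrite big1 ?mulr1 // => i _; rewrite expr1n.
Qed.

(* The operator is the nonzero scalar [Phi.@[1]] up to terms lowering the
   degree. *)
Lemma shift_op_inj Phi : Phi.@[fun=> 1] != 0 -> injective (shift_op Phi).
Proof.
move=> nz; suff act0 P : shift_op Phi P = 0 -> P = 0.
  by move=> P Q eqPQ; apply/subr0_eq/act0; rewrite linearB /= eqPQ subrr.
move=> act0; apply/eqP.
rewrite -msize_poly_eq0 -leqn0 leqNgt; apply/negP => P_gt0.
have eqP : Phi.@[fun=> 1] *: P = - \sum_(u <- msupp Phi) Phi@_u *:
  (shiftm u P - P).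
  rewrite mevalE1 scaler_suml -sumrN -[LHS]subr0 -[X in _ - X]act0 /shift_op
    -sumrB.
  by apply: eq_bigr => u _; rewrite scalerBr opprB.
have : (msize (Phi.@[fun=> 1%R] *: P) <= msize P - 1)%N.
  rewrite eqP msizeN (leq_trans (msize_sum _ _ _)) //.
  apply/bigmax_leqP_seq => u _ _.
  exact: leq_trans (msizeZ_le _ _) (msize_shiftmB _ _).
by rewrite msizeZ // leqNgt subn1 prednK ?leqnn.
Qed.

End Action.

(* Intertwining relations need only be checked on the generators. *)
Lemma shift_op_subst n k (T : {linear {mpoly rat[n]} -> {mpoly rat[k]}})
    (g : 'I_k -> {mpoly rat[n]}) :
  (forall i P, E i (T P) = T (shift_op (g i) P)) ->
  forall Phi P, shift_op Phi (T P) = T (shift_op (subst g Phi) P).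
Proof.
move=> shift_opT Phi; elim/mpoly_XU_ind: Phi =>
  [c|i|Phi Psi IH1 IH2|Phi Psi IH1 IH2] P.
- by rewrite substC !shift_opC linearZ.
- by rewrite substX shift_opX shift_opT.
- by rewrite rmorphD /= !shift_opDl IH1 IH2 linearD.
- by rewrite rmorphM /= !shift_opM IH2 IH1.
Qed.

(** * The operator [factors] *)

Section Factors.
Variable m : nat.
Implicit Types (P Q R Phi Psi : {mpoly rat[m]}) (i j p q : 'I_m).

(** The inverse of [factor p q] is (1 + X_q (X_p - 1)) X_p^-1 (1 + X_q^-1 (X_p - 1)), which equals
    [factor_den p q] / (X_p X_q). *)
Definition factor_den p q : {mpoly rat[m]} :=
  (1 - 'X_q + 'X_p * 'X_q) * ('X_p + 'X_q - 1).

Definition factors_den :=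
  \prod_(pq : 'I_m * 'I_m | (pq.1 < pq.2)%N) factor_den pq.1 pq.2.
Definition factors_num : {mpoly rat[m]} :=
  \prod_(pq : 'I_m * 'I_m | (pq.1 < pq.2)%N) ('X_pq.1 * 'X_pq.2).

Lemma E_subst i P :
  E i P = subst (fun j => 'X_j + (if j == i then 1 else 0)%:MP) P.
Proof. by []. Qed.

Lemma shift_shiftN i c P : shift i c (shift i (- c) P) = P.
Proof.
rewrite -[RHS]subst_id -![shift i _ _]/(subst _ _) subst_comp.
apply: eq_subst => j; rewrite rmorphD /= substX substC -addrA -mpolyCD.
by case: eqP => _; rewrite ?subrr ?(addr0 0) mpolyC0 addr0.
Qed.

Lemma shift_op_factor p q P : shift_op (factor_den p q) (factor p q P) =
  shift_op ('X_p * 'X_q) P.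
Proof.
rewrite /factor_den mulrC !shift_opM /factor /=; set S := id_add_inv _ P.
set R := id_add_inv _ (E p S).
(* The operator id + E_q Delta_p undoes the outer series; the other one, E_q (id + E_q^-1 Delta_p) =
   E_p + E_q - id, undoes the inner series. *)
have -> : shift_op (1 - 'X_q + 'X_p * 'X_q) R = E p S.
  rewrite -[RHS](id_add_invK p q 1 (E p S)) -/R /= -[shift q 1 _]/(E q _).
  rewrite -shift_opXB1 -shift_opX -shift_opM -[X in _ = X + _]shift_op1
    -shift_opDl; congr (shift_op _ R); ring.
rewrite -(shift_opX p S) shift_op_comm; congr (shift_op _ _).
rewrite -[in RHS](id_add_invK p q (-1) P) -/S linearD /=.
rewrite [shift_op 'X_q (shift _ _ _)]shift_opX /E shift_shiftN -shift_opXB1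
  -shift_opDl.
by congr (shift_op _ S); ring.
Qed.

Lemma shift_op_factors P :
  shift_op factors_den (factors P) = shift_op factors_num P.
Proof.
rewrite /factors_den /factors_num /factors; elim: (index_enum _) P =>
  [|pq s IH] P.
  by rewrite !big_nil.
rewrite !big_cons; case: ifP => // _ /=.
by rewrite [factor_den _ _ * _]mulrC [LHS]shift_opM shift_op_factor
  shift_op_comm IH -!shift_opM mulrC.
Qed.

Lemma factors_den1 : factors_den.@[fun=> 1] != 0.
Proof.
rewrite /factors_den rmorph_prod prodf_seq_neq0; apply/allP => -[p q] _.
apply/implyP => _ /=.
rewrite /factor_den mevalM !(mevalB, mevalD, mevalM, meval1, mevalXU).
by rewrite [X in X != _](_ : _ = 1) ?oner_neq0 //; ring.
Qed.

(** [factors_den] acts injectively, so the equation determines [factors P]. Properties of [factors]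
    then reduce to properties of the polynomials [factors_den] and [factors_num]. *)
Lemma factors_unique P R :
  shift_op factors_den R = shift_op factors_num P -> factors P = R.
Proof. by move=> eqR; apply: (shift_op_inj factors_den1); rewrite
  shift_op_factors. Qed.

Lemma factors_is_linear : linear (@factors m).
Proof.
by move=> a P Q; apply: factors_unique; rewrite !linearP /= !shift_op_factors.
Qed.
HB.instance Definition _ :=
  GRing.isLinear.Build rat {mpoly rat[m]} {mpoly rat[m]} _ (@factors m)
    factors_is_linear.

Lemma factors_shift_op Psi P :
  factors (shift_op Psi P) = shift_op Psi (factors P).
Proof. by apply: factors_unique; rewrite shift_op_comm shift_op_factors
  shift_op_comm. Qed.

Definition psubst (s : {perm 'I_m}) : {mpoly rat[m]} -> {mpoly rat[m]} :=
  subst (fun i => 'X_(s i)).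
HB.instance Definition _ s := GRing.LRMorphism.on (psubst s).


Lemma shift_op_psubst s Phi P :
  shift_op Phi (psubst s P) = psubst s (shift_op (psubst s^-1 Phi) P).
Proof.
apply: shift_op_subst => i {}P; rewrite shift_opX /= !E_subst /psubst
  !subst_comp.
apply: eq_subst => j; rewrite rmorphD /= !substX substC.
by rewrite -[in RHS](inj_eq (@perm_inj _ s)) permKV.
Qed.


(** * Exchange of two adjacent variables *)

Section Adjacent.
Variables i j : 'I_m.
Hypothesis ij : j = i.+1 :> nat.
Let s := tperm i j.

(** Exchanging neighbours keeps the order of every pair p < q except (i, j) itself, so it permutes
    the index set of the product. *)
Lemma psubst_prod_adjacent (F : 'I_m -> 'I_m -> {mpoly rat[m]}) :
  (forall p q, psubst s (F p q) = F (s p) (s q)) ->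
  psubst s (\prod_(pq : 'I_m * 'I_m | (pq.1 < pq.2)%N && (pq != (i, j)))
    F pq.1 pq.2) =
  \prod_(pq : 'I_m * 'I_m | (pq.1 < pq.2)%N && (pq != (i, j))) F pq.1 pq.2.
Proof.
move=> sF; rewrite rmorph_prod /= (eq_bigr _ (fun pq _ => sF pq.1 pq.2)).
have s2K : involutive (fun pq : 'I_m * 'I_m => (s pq.1, s pq.2)).
  by case=> p q /=; rewrite !tpermK.
rewrite [RHS](reindex_inj (inv_inj s2K)) /=; apply: eq_bigl => -[p q] /=.
rewrite !xpair_eqE -!val_eqE /= /s.
by case: (tpermP i j p) => [->|->|/eqP + /eqP]; case: (tpermP i j q) =>
  [->|->|/eqP + /eqP];
  rewrite -?val_eqE /= ?ij; lia.
Qed.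

Lemma psubstX s' p : psubst s' 'X_p = 'X_(s' p).
Proof. exact: substX. Qed.

Lemma ij_lt : (i < j)%N. Proof. by rewrite ij. Qed.

(* Without the factor [id - E j + E i * E j], the product [factors_den] is
   symmetric in [i] and [j]. *)
Lemma psubst_factors P : psubst s P = - P ->
  let R := shift_op (1 - 'X_j + 'X_i * 'X_j) (factors P) in psubst s R = - R.
Proof.
move=> sP R.
pose Phi' := ('X_i + 'X_j - 1) *
  \prod_(pq : 'I_m * 'I_m | (pq.1 < pq.2)%N && (pq != (i, j)))
    factor_den pq.1 pq.2.
have denE : factors_den = (1 - 'X_j + 'X_i * 'X_j) * Phi'.
  by rewrite /factors_den (bigD1 (i, j)) ?ij_lt //= mulrA.
have inj' : injective (shift_op Phi').
  apply: shift_op_inj; move: factors_den1; rewrite denE mevalM mulf_eq0 negb_or.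
  by case/andP.
have sPhi' : psubst s^-1 Phi' = Phi'.
  rewrite tpermV rmorphM /= psubst_prod_adjacent => [|p q]; last first.
    by rewrite /factor_den !(rmorphB, rmorphD, rmorphM, rmorph1) /= !psubstX.
  by rewrite rmorphB rmorphD rmorph1 /= !psubstX tpermL tpermR ['X_j + _]addrC.
have sTh : psubst s^-1 factors_num = factors_num.
  rewrite tpermV /factors_num (bigD1 (i, j)) ?ij_lt //= rmorphM /=.
  rewrite (psubst_prod_adjacent (F := fun p q => 'X_p * 'X_q)) => [|p q]; last
    first.
    by rewrite rmorphM /= !psubstX.
  by rewrite rmorphM /= !psubstX tpermL tpermR ['X_j * _]mulrC.
have R_def : shift_op Phi' R = shift_op factors_num P.
  by rewrite /R -shift_opM mulrC -denE shift_op_factors.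
apply: inj'; rewrite shift_op_psubst sPhi' R_def -[in LHS]sTh -shift_op_psubst
  sP.
by rewrite linearN /= -R_def linearN.
Qed.

(** The exchange fixes a point with [v i = v j], so there the antisymmetric polynomial of
    [psubst_factors] equals its own negative. *)
Lemma factors_adjacent P (v : 'I_m -> rat) : psubst s P = - P -> v i = v j ->
  let G := factors P in G.@[v] - (E j G).@[v] + (E i (E j G)).@[v] = 0.
Proof.
move=> sP vij G; have := psubst_factors sP.
rewrite -/G shift_opDl shift_opBl shift_op1 shift_opM !shift_opX /= =>
  /(congr1 (meval v)).
rewrite subst_eval (@meval_eq _ _ _ v) => [|p]; last first.
  by rewrite mevalXU /s; case: tpermP => // ->.
by rewrite mevalN mevalD mevalB => /eqP; rewrite -addr_eq0 -mulr2n mulrn_eq0 =>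
  /eqP.
Qed.

End Adjacent.

(** * Reflection of the last variable *)

Section Reflection.
Variables (q : 'I_m) (c : rat).
Hypothesis q_max : forall p, (p <= q)%N.

Definition reflect_var :=
  subst (fun p => if p == q then c%:MP - 'X_q else 'X_p : {mpoly rat[m]}).
HB.instance Definition _ := GRing.LRMorphism.on reflect_var.

(** Conjugation by the reflection replaces X_q by X_q^-1, so the condition says Phi(X_q) = X_q^e
    Phi(X_q^-1) as operators. *)
Definition palindromic e Phi := forall R,
  shift_op Phi (reflect_var R) = shift_op ('X_q ^+ e)
    (reflect_var (shift_op Phi R)).

Lemma palindromicD e Phi Psi :
  palindromic e Phi -> palindromic e Psi -> palindromic e (Phi + Psi).
Proof. by move=> H1 H2 R; rewrite !shift_opDl H1 H2 !linearD. Qed.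

Lemma palindromicM e f Phi Psi :
  palindromic e Phi -> palindromic f Psi -> palindromic (e + f) (Phi * Psi).
Proof.
by move=> H1 H2 R; rewrite !shift_opM H2 shift_op_comm H1 exprD shift_opM
  shift_op_comm.
Qed.

Lemma palindromicC a : palindromic 0 a%:MP.
Proof. by move=> R; rewrite expr0 shift_op1 !shift_opC linearZ. Qed.

Lemma palindromicX p : p != q -> palindromic 0 'X_p.
Proof.
move=> pq R; rewrite expr0 shift_op1 !shift_opX !E_subst /reflect_var
  !subst_comp.
apply: eq_subst => k; rewrite rmorphD /= !substX substC.
have [->|kq] := eqVneq k q; first by rewrite rmorphB /= substX substC
  [q == p]eq_sym (negbTE pq) !addr0.
by rewrite substX.
Qed.

Lemma reflect_varE R : E q (reflect_var (E q R)) = reflect_var R.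
Proof.
rewrite -![E _ _]/(subst _ _) !subst_comp.
apply: eq_subst => k; rewrite rmorphD /= !substX substC.
have [_|kq] := eqVneq k q; last by rewrite substX (negbTE kq) mpolyC0 !addr0.
by rewrite rmorphB /= substX substC eqxx; ring.
Qed.

Lemma palindromicXq : palindromic 2 'X_q.
Proof. by move=> R; rewrite expr2 shift_opM !shift_opX reflect_varE. Qed.

Lemma palindromicXq2 : palindromic 2 (1 + 'X_q ^+ 2).
Proof.
move=> R; rewrite expr2 !shift_opDl !shift_op1 !shift_opM !linearD /=
  !shift_opX.
by rewrite !reflect_varE addrC.
Qed.

(** As [q] is maximal, it occurs in a pair p < p' only as the larger index; such a pair adds 2 to
    the palindromic exponent. *)
Let deg (pq : 'I_m * 'I_m) := (if pq.2 == q then 2 else 0)%N.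

Lemma palindromic_prod (F : 'I_m -> 'I_m -> {mpoly rat[m]}) :
  (forall p p', (p < p')%N -> palindromic (deg (p, p')) (F p p')) ->
  palindromic (\sum_(pq : 'I_m * 'I_m | (pq.1 < pq.2)%N) deg pq)
    (\prod_(pq : 'I_m * 'I_m | (pq.1 < pq.2)%N) F pq.1 pq.2).
Proof.
move=> HF; apply: (big_rec2 (fun Phi e => palindromic e Phi)) =>
  [|[p p'] e Phi lt IH].
  by rewrite -mpolyC1; apply: palindromicC.
by apply: palindromicM; [apply: HF | apply: IH].
Qed.

Lemma lt_neq_max p p' : (p < p')%N -> p != q.
Proof.
by move=> lt; apply/eqP => pq; have := q_max p'; rewrite leqNgt -pq lt.
Qed.

Lemma palindromic_den :
  palindromic (\sum_(pq : 'I_m * 'I_m | (pq.1 < pq.2)%N) deg pq) factors_den.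
Proof.
apply: palindromic_prod => p p' lt; have pq := lt_neq_max lt.
have palXB1 r : r != q -> palindromic 0 ('X_r - 1).
  move=> rq; rewrite -[1]mpolyC1 -mpolyCN.
  by apply: palindromicD (palindromicC _); apply: palindromicX.
rewrite /deg /=; case: eqP => [->|/eqP p'q]; last first.
  rewrite (_ : factor_den p p' = (1 + ('X_p - 1) * 'X_p') *
    ('X_p' + ('X_p - 1))); last first.
    by rewrite /factor_den; ring.
  apply: (@palindromicM 0 0); last by apply: palindromicD;
    [apply: palindromicX | apply: palXB1].
  rewrite -[1 in X in palindromic _ (X + _)]mpolyC1.
  apply: palindromicD; first exact: palindromicC.
  by apply: (@palindromicM 0 0); [apply: palXB1 | apply: palindromicX].
(* As a quadratic in X_q the factor has equal outer coefficients X_p - 1. *)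
rewrite (_ : factor_den p q = ('X_p - 1) * (1 + 'X_q ^+ 2) +
  (1 + ('X_p - 1) * ('X_p - 1)) * 'X_q); last first.
  by rewrite /factor_den; ring.
apply: palindromicD; first by apply: (@palindromicM 0 2);
  [apply: palXB1 | apply: palindromicXq2].
apply: (@palindromicM 0 2); last exact: palindromicXq.
rewrite -[1 in X in palindromic _ (X + _)]mpolyC1.
apply: palindromicD; first exact: palindromicC.
by apply: (@palindromicM 0 0); apply: palXB1.
Qed.

Lemma palindromic_num :
  palindromic (\sum_(pq : 'I_m * 'I_m | (pq.1 < pq.2)%N) deg pq) factors_num.
Proof.
apply: (@palindromic_prod (fun p q => 'X_p * 'X_q)) => p p' lt; have pq :=
  lt_neq_max lt.
rewrite /deg /=; case: eqP => [->|/eqP p'q].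
  by apply: (@palindromicM 0 2); [apply: palindromicX | apply: palindromicXq].
by apply: (@palindromicM 0 0); apply: palindromicX.
Qed.

(** Numerator and denominator are palindromic with the same exponent, so the same power of X_q
    arises on both sides. *)
Lemma factors_reflect P : factors (reflect_var P) = reflect_var (factors P).
Proof.
apply: factors_unique.
by rewrite palindromic_den shift_op_factors -palindromic_num.
Qed.

End Reflection.

End Factors.

(** * Polynomials that do not depend on one variable *)

Section Omit.
Variables (n : nat) (t : 'I_n.+1).

Definition omit : {mpoly rat[n]} -> {mpoly rat[n.+1]} := subst
  (fun i => 'X_(lift t i)).
HB.instance Definition _ := GRing.LRMorphism.on omit.

(** On polynomials free of k_t the shift [E t] is the identity; hence X_t is specialised to 1. *)
Definition set1 : {mpoly rat[n.+1]} -> {mpoly rat[n]} :=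
  subst (fun i => if unlift t i is Some j then 'X_j else 1).
HB.instance Definition _ := GRing.LRMorphism.on set1.

Lemma shift_op_omit Phi P : shift_op Phi (omit P) = omit
  (shift_op (set1 Phi) P).
Proof.
apply: shift_op_subst => i {}P; rewrite /= E_subst /omit subst_comp.
case: unliftP => [j|] ->; rewrite ?shift_op1 ?shift_opX ?E_subst ?subst_comp;
  apply: eq_subst => k; rewrite substX.
  by rewrite rmorphD /= substX substC (inj_eq (@lift_inj _ t)).
by rewrite eq_sym (negbTE (neq_lift _ _)) addr0.
Qed.

Lemma set1X i : set1 'X_(lift t i) = 'X_i.
Proof. by rewrite /set1 substX liftK. Qed.

Lemma set1Xt : set1 'X_t = 1.
Proof. by rewrite /set1 substX unlift_none. Qed.

Lemma prod_ord_pairs (R : comPzSemiRingType) (F : 'I_n.+1 -> 'I_n.+1 -> R) :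
  \prod_(pq : 'I_n.+1 * 'I_n.+1 | (pq.1 < pq.2)%N) F pq.1 pq.2 =
  (\prod_(pq : 'I_n * 'I_n | (pq.1 < pq.2)%N) F (lift t pq.1) (lift t pq.2)) *
  (\prod_(p < n | (p < t)%N) F (lift t p) t) *
  (\prod_(q < n | (t <= q)%N) F t (lift t q)).
Proof.
rewrite -(pair_big_dep xpredT (fun p q : 'I_n.+1 => (p < q)%N) F) /=.
rewrite -(pair_big_dep xpredT (fun p q : 'I_n => (p < q)%N)
  (fun p q => F (lift t p) (lift t q))) /=.
rewrite (bigD1_ord t) //= mulrC; congr (_ * _); last first.
  rewrite big_mkcond (bigD1_ord t) //= ltnn mul1r -big_mkcond /=.
  by apply: eq_bigl => q; rewrite /bump; case: leqP; lia.
rewrite [X in _ = _ * X]big_mkcond -big_split /=; apply: eq_bigr => p _.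
rewrite big_mkcond (bigD1_ord t) //= mulrC -big_mkcond /=; congr (_ * _).
  by apply: eq_bigl => q; rewrite /bump; do 2?case: leqP; lia.
by rewrite /bump; case: leqP => ?; case: ltnP => ? //; lia.
Qed.

(** At X_t = 1 a pair p < t contributes X_p / X_p^2 to the quotient [factors_num] / [factors_den],
    and a pair t < q contributes X_q / X_q. Multiplication by all the variables turns the remaining
    product of X_p^-1 before t into the product of the X_q after t. *)
Lemma factors_omit Q :
  factors (omit (shift_op (\prod_j 'X_j) Q)) =
  omit (shift_op (\prod_(q < n | (t <= q)%N) 'X_q) (factors Q)).
Proof.
apply: factors_unique; rewrite !shift_op_omit -!shift_opM; congr (omit _).
rewrite /factors_den /factors_num prod_ord_pairs
  (prod_ord_pairs (fun p q => 'X_p * 'X_q)).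
rewrite !rmorphM !rmorph_prod /=.
pose A : {mpoly rat[n]} := \prod_(p < n | (p < t)%N) 'X_p.
pose B : {mpoly rat[n]} := \prod_(q < n | (t <= q)%N) 'X_q.
have eA : \prod_(p < n | (p < t)%N) set1 (factor_den (lift t p) t) = A * A.
  rewrite /A -big_split; apply: eq_bigr => p _.
  by rewrite /factor_den rmorphM !(rmorphB, rmorphD) rmorphM rmorph1 /= !set1X
    set1Xt; ring.
have eB : \prod_(q < n | (t <= q)%N) set1 (factor_den t (lift t q)) = B.
  apply: eq_bigr => q _.
  by rewrite /factor_den rmorphM !(rmorphB, rmorphD) rmorphM rmorph1 /= !set1X
    set1Xt; ring.
have eA' : \prod_(p < n | (p < t)%N) set1 ('X_(lift t p) * 'X_t) = A.
  by apply: eq_bigr => p _; rewrite rmorphM /= set1X set1Xt mulr1.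
have eB' : \prod_(q < n | (t <= q)%N) set1 ('X_t * 'X_(lift t q)) = B.
  by apply: eq_bigr => q _; rewrite rmorphM /= set1X set1Xt mul1r.
have eAB : \prod_(i < n) 'X_i = A * B.
  rewrite (bigID (fun i : 'I_n => (i < t)%N)) /=.
  by congr (_ * _); apply: eq_bigl => i; rewrite -leqNgt.
rewrite eA eB eA' eB' eAB -/B.
under eq_bigr => pq _ do rewrite /factor_den rmorphM !(rmorphB, rmorphD)
  rmorphM rmorph1 /= !set1X -/(factor_den _ _).
under [in RHS]eq_bigr => pq _ do rewrite rmorphM /= !set1X.
rewrite -/(factors_den n) -/(factors_num n) -!mulrA mulrC [LHS]shift_opM
  shift_op_factors -shift_opM; congr (shift_op _ _).
ring.
Qed.

End Omit.

(** * Determinants of univariate polynomials *)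

Lemma subst_horner_alg n k (f : 'I_n -> {mpoly rat[k]}) i (p : {poly rat}) :
  subst f (horner_alg 'X_i p) = horner_alg (f i) p.
Proof.
elim/poly_ind: p => [|p c IH]; first by rewrite !rmorph0.
by rewrite !rmorphD !rmorphM /= IH !horner_algX !horner_algC substX linearZ
  rmorph1.
Qed.

Lemma horner_alg_comp (A : algType rat) (a : A) (p q : {poly rat}) :
  horner_alg a (p \Po q) = horner_alg (horner_alg a q) p.
Proof.
elim/poly_ind: p => [|p c IH]; first by rewrite comp_poly0 !rmorph0.
rewrite comp_polyD comp_polyM comp_polyX comp_polyC !rmorphD !rmorphM /= IH.
by rewrite !horner_algX !horner_algC.
Qed.

Lemma horner_algXB1 (A : algType rat) (a : A) : horner_alg (a + 1) ('X - 1) = a.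
Proof. by rewrite rmorphB rmorph1 /= horner_algX addrK. Qed.

Section PolyDeterminants.
Variable m : nat.
Implicit Types (c : nat -> {poly rat}) (i j : 'I_m).

Definition polymx c : 'M[{mpoly rat[m]}]_m :=
  \matrix_(i, j) horner_alg 'X_i (c j).
Definition polydet c := \det (polymx c).

Lemma eq_polydet c c' : c =1 c' -> polydet c = polydet c'.
Proof. by move=> cc'; congr (\det _); apply/matrixP => i j; rewrite !mxE cc'.
  Qed.

Lemma subst_polydet k (f : 'I_m -> {mpoly rat[k]}) c :
  subst f (polydet c) = \det (\matrix_(i, j) horner_alg (f i) (c j)).
Proof.
rewrite /polydet -det_map_mx; congr (\det _); apply/matrixP => i j.
by rewrite !mxE /= subst_horner_alg.
Qed.

Lemma psubst_polydet c i j : i != j ->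
  psubst (tperm i j) (polydet c) = - polydet c.
Proof.
move=> ij; rewrite [LHS]subst_polydet.
have -> : \matrix_(p, q) horner_alg 'X_(tperm i j p) (c q) =
    row_perm (tperm i j) (polymx c) by apply/matrixP => p q; rewrite !mxE.
by rewrite row_permE det_mulmx det_perm odd_tperm ij expr1 mulN1r.
Qed.

(** The variable k_i occurs in row [i] only, so by multilinearity [Delta i] acts on that row
    alone. *)
Lemma foldr_Delta_det c (s : seq 'I_m) : uniq s ->
  foldr (@Delta m) (polydet c) s =
  \det (\matrix_(i, j) horner_alg 'X_i
     (if i \in s then (c j \Po ('X + 1)) - c j else c j) :
       'M[{mpoly rat[m]}]_m).
Proof.
elim: s => [_|k s IH /= /andP[ks us]]; first by congr (\det _).
rewrite IH // /Delta E_subst -det_map_mx.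
set B := map_mx _ _; set C := \matrix_(i, j) _; set A := \matrix_(i, j) _.
rewrite (@determinant_multilinear _ _ A B C k 1 (-1)) ?mul1r ?mulN1r //.
- rewrite scale1r scaleN1r; apply/rowP => j.
  rewrite !mxE mem_head (negbTE ks) /=.
  rewrite subst_horner_alg eqxx [LHS]rmorphB /= horner_alg_comp.
  by rewrite rmorphD /= horner_algX rmorph1.
- apply/matrixP => i j; rewrite !mxE /= inE eq_sym (negbTE (neq_lift _ _)) /=.
  by rewrite subst_horner_alg eq_sym (negbTE (neq_lift _ _)) mpolyC0 addr0.
- by apply/matrixP => i j; rewrite !mxE /= inE eq_sym (negbTE (neq_lift _ _)).
Qed.

Lemma Delta_polydet c :
  foldr (@Delta m) (polydet c) (enum 'I_m) =
  polydet (fun j : nat => (c j \Po ('X + 1)) - c j).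
Proof.
rewrite foldr_Delta_det ?enum_uniq //; congr (\det _).
by apply/matrixP => i j; rewrite !mxE mem_enum.
Qed.

Lemma polydetZ (a : nat -> rat) c :
  polydet (fun j : nat => a j *: c j) = (\prod_(j < m) a j) *: polydet c.
Proof.
rewrite /polydet; have -> : polymx (fun j : nat => a j *: c j) = polymx c *m
  diag_mx (\row_j (a j)%:MP).
  by apply/matrixP => i j; rewrite mul_mx_diag !mxE linearZ /= -mul_mpolyC
    mulrC ?mulr1.
rewrite det_mulmx det_diag mulrC -mul_mpolyC rmorph_prod /=; congr (_ * _).
by apply: eq_bigr => j _; rewrite mxE.
Qed.

(** As [g j] has degree j, the matrix is the product of a triangular coefficient matrix and a
    Vandermonde matrix in the values of [w]. *)
Lemma polydet_Vandermonde (g : nat -> {poly rat}) (w : {poly rat}) :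
  (forall j, size (g j) = j.+1) ->
  polydet (fun j : nat => g j \Po w) =
  (\prod_(j < m) lead_coef (g j)) *:
    \prod_(i < m) \prod_(j < m | (i < j)%N)
      (horner_alg 'X_j w - horner_alg 'X_i w).
Proof.
move=> sg; pose z : 'rV[{mpoly rat[m]}]_m := \row_i horner_alg 'X_i w.
pose C : 'M[{mpoly rat[m]}]_m := \matrix_(j, k) ((g j)`_k)%:MP.
have trC : is_trig_mx C.
  by apply/is_trig_mxP => i j ij; rewrite mxE nth_default ?mpolyC0 // sg.
rewrite /polydet -det_tr.
have -> : (polymx (fun j : nat => g j \Po w))^T = C *m Vandermonde m z.
  apply/matrixP => j i; rewrite !mxE horner_alg_comp.
  have {1}-> : g j = \sum_(k < m) (g j)`_k *: 'X^k.
    rewrite -(poly_def m (fun k => (g j)`_k)); apply/polyP => k.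
    by rewrite coef_poly; case: ltnP => // mk; rewrite nth_default // sg;
      apply: leq_trans mk.
  rewrite linear_sum; apply: eq_bigr => k _.
  by rewrite !mxE linearZ rmorphXn /= horner_algX -mul_mpolyC mulr1.
rewrite det_mulmx det_trig // det_Vandermonde.
rewrite -mul_mpolyC rmorph_prod /=; congr (_ * _).
  by apply: eq_bigr => j _; rewrite mxE lead_coefE sg.
by apply: eq_bigr => i _; apply: eq_bigr => j _; rewrite !mxE.
Qed.

End PolyDeterminants.

Lemma polydet_omit n c : c 0%N = 1 ->
  polydet n.+1 c =
  \sum_(t < n.+1) (-1) ^+ t *: omit t (polydet n (fun j => c j.+1)).
Proof.
move=> c0; rewrite /polydet (expand_det_col _ ord0); apply: eq_bigr => t _.
rewrite !mxE c0 rmorph1 mul1r /cofactor addn0 -signr_odd -[in RHS]signr_odd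
  mulr_sign scaler_sign.
have -> : row' t (col' ord0 (polymx n.+1 c)) =
    \matrix_(i, j) horner_alg 'X_(lift t i) (c j.+1).
  by apply/matrixP => i j; rewrite !mxE lift0.
by rewrite -[omit t _]/(subst _ _) subst_polydet.
Qed.

Lemma shift_op_prodX m (a : pred 'I_m) P :
  shift_op (\prod_(j | a j) 'X_j) P = subst (fun j => 'X_j + (a j)%:R) P.
Proof.
have -> : \prod_(j | a j) 'X_j = 'X_[[multinom (a j : nat) | j < m]] :>
  {mpoly rat[m]}.
  rewrite mpolyXE_id big_mkcond; apply: eq_bigr => j _.
  by rewrite mnmE; case: (a j); rewrite ?expr1 ?expr0.
rewrite shift_opXm; apply: eq_subst => j.
by rewrite mnmE; case: (a j); rewrite ?mpolyC1 ?mpolyC0.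
Qed.

Lemma shift_op_prodX_polydet m c :
  shift_op (\prod_j 'X_j) (polydet m (fun j => c j \Po ('X - 1))) = polydet m c.
Proof.
rewrite shift_op_prodX subst_polydet; congr (\det _); apply/matrixP => i j.
rewrite !mxE horner_alg_comp; congr (horner_alg _ _).
exact: horner_algXB1.
Qed.

(** * Central factorials and the product formulas *)

Section CentralFactorials.
Variable R : comNzRingType.
Implicit Types (u : R) (j : nat).

(** Products of consecutive factors: [evenfac j u] is (2j)! C(u + j - 1, 2j), and [oddfac j u] is
    (2j + 1)! C(u + j, 2j + 1). *)
Definition evenfac j u := \prod_(s < j) ((u + s%:R) * (u - s.+1%:R)).
Definition oddfac j u := u * \prod_(s < j) ((u + s.+1%:R) * (u - s.+1%:R)).

Lemma oddfacE j u : oddfac j u = (u + j%:R) * evenfac j u.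
Proof.
rewrite /oddfac /evenfac; elim: j => [|j IH]; first by rewrite !big_ord0 addr0.
by rewrite !big_ord_recr /= mulrA IH; ring.
Qed.

Lemma oddfacB1 j u : oddfac j (u - 1) = (u - j.+1%:R) * evenfac j u.
Proof.
rewrite /oddfac /evenfac; elim: j => [|j IH]; first by rewrite !big_ord0.
rewrite !big_ord_recr /= mulrA IH.
by rewrite -[j.+2%:R]natr1 -[j.+1%:R]natr1; ring.
Qed.

Lemma evenfacS j u : evenfac j.+1 u = (u - j.+1%:R) * oddfac j u.
Proof. by rewrite oddfacE /evenfac big_ord_recr /=; ring. Qed.

Lemma evenfacSD1 j u : evenfac j.+1 (u + 1) = (u + j.+1%:R) * oddfac j u.
Proof.
have := oddfacB1 j (u + 1); rewrite addrK => ->.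
by rewrite /evenfac big_ord_recr /= -[j.+1%:R]natr1; ring.
Qed.

Lemma oddfacN j u : oddfac j (- u) = - oddfac j u.
Proof.
rewrite /oddfac mulNr; congr (- (_ * _)); apply: eq_bigr => s _; ring.
Qed.

End CentralFactorials.

Lemma rmorph_evenfac (R S : comNzRingType) (f : {rmorphism R -> S}) j u :
  f (evenfac j u) = evenfac j (f u).
Proof.
rewrite rmorph_prod; apply: eq_bigr => s _.
by rewrite rmorphM rmorphD rmorphB !rmorph_nat.
Qed.

Lemma rmorph_oddfac (R S : comNzRingType) (f : {rmorphism R -> S}) j u :
  f (oddfac j u) = oddfac j (f u).
Proof.
rewrite rmorphM rmorph_prod; congr (_ * _); apply: eq_bigr => s _.
by rewrite rmorphM rmorphD rmorphB !rmorph_nat.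
Qed.

Section Bases.
Variable x : int.

Definition upoly : {poly rat} := (x + 1)%:~R - 'X.
Definition evenbase j : {poly rat} :=
  ((-1) ^+ j / (j.*2)`!%:R) *: evenfac j upoly.
Definition oddbase j : {poly rat} :=
  ((-1) ^+ j / (j.*2.+1)`!%:R) *: oddfac j upoly.

Lemma evenbase0 : evenbase 0 = 1.
Proof. by rewrite /evenbase /evenfac big_ord0 divr1 scale1r. Qed.

Lemma comp_upoly (c : rat) : upoly \Po ('X + c%:P) = upoly - c%:P.
Proof. by rewrite rmorphB /= rmorph_int comp_polyX opprD addrA. Qed.

(** Pascal's rule for C(u + j, 2j + 1); raising k by 1 lowers u by 1, whence the sign. *)
Lemma diff_oddbase j : oddbase j \Po ('X + 1) - oddbase j = - evenbase j.
Proof.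
rewrite /oddbase /evenbase comp_polyZ -scalerBr.
rewrite (rmorph_oddfac (comp_poly ('X + 1))) /= comp_upoly oddfacB1 oddfacE
  -mulrBl.
have -> : upoly - j.+1%:R - (upoly + j%:R) = - (j.*2.+1%:R)%:P.
  by rewrite polyC_natr -addnn -addnS natrD; ring.
rewrite mulNr mul_polyC scalerN scalerA; congr (- (_ *: _)).
rewrite factS natrM invfM [_^-1 / _]mulrC mulrA mulfVK //.
by rewrite pnatr_eq0.
Qed.

(** Pascal's rule for a backward difference: C(u + j + 1, 2j + 2) - C(u + j, 2j + 2) = C(u + j, 2j +
    1). *)
Lemma diff_evenbase j :
  evenbase j.+1 - (evenbase j.+1 \Po ('X - 1)) = oddbase j.
Proof.
rewrite /oddbase /evenbase comp_polyZ -scalerBr.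
rewrite -[X in 'X - X]polyC1 -polyCN (rmorph_evenfac (comp_poly _)) /=
  comp_upoly polyCN opprK.
rewrite evenfacS evenfacSD1 -mulrBl.
have -> : upoly - j.+1%:R - (upoly + j.+1%:R) = - (j.*2.+2%:R)%:P.
  by rewrite polyC_natr -addnn -addSn -addnS natrD; ring.
rewrite mulNr mul_polyC scalerN scalerA -scaleNr; congr (_ *: _).
rewrite doubleS factS natrM invfM exprS mulN1r !mulNr opprK [_^-1 / _]mulrC
  mulrA mulfVK //.
by rewrite pnatr_eq0.
Qed.

(** With u = x + 1 - k one has (u + s) (u - s - 1) = x (x + 1) - s (s + 1) - z; the sign (-1)^j
    makes every factor monic in z. *)
Lemma evenbaseE j (z := 'X * ((2 * x + 1)%:~R - 'X) : {poly rat}) :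
  evenbase j = ((j.*2)`!%:R^-1 *:
    \prod_(s < j) ('X - ((x + 1) * x - s.+1%:R * s%:R)%:~R%:P)) \Po z.
Proof.
rewrite /evenbase comp_polyZ mulrC -scalerA; congr (_ *: _).
rewrite rmorph_prod /= -mul_polyC rmorphXn rmorphN1 -[X in _ ^+ X](card_ord j)
  -prodr_const /=.
rewrite /evenfac -big_split; apply: eq_bigr => s _ /=.
rewrite comp_polyB comp_polyX comp_polyC /upoly /z.
rewrite !(rmorphM, rmorphD, rmorphB, rmorph1, rmorph_nat) /=.
by rewrite -[s.+1%:R]natr1; ring.
Qed.

Lemma oddbaseE j (z := 'X * ((2 * x + 2)%:~R - 'X) : {poly rat}) :
  oddbase j = upoly * (((j.*2.+1)`!%:R^-1 *:
    \prod_(s < j) ('X - ((x + 1) * (x + 1) - s.+1%:R * s.+1%:R)%:~R%:P)) \Po z).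
Proof.
rewrite /oddbase /oddfac comp_polyZ mulrC -scalerA -scalerAr; congr (_ *: _).
rewrite scalerAr; congr (_ * _).
rewrite rmorph_prod /= -mul_polyC rmorphXn rmorphN1 -[X in _ ^+ X](card_ord j)
  -prodr_const /=.
rewrite -big_split; apply: eq_bigr => s _ /=.
rewrite comp_polyB comp_polyX comp_polyC /upoly /z.
rewrite !(rmorphM, rmorphD, rmorphB, rmorph1, rmorph_nat) /=.
by rewrite -[s.+1%:R]natr1; ring.
Qed.


End Bases.

Lemma size_monic_scale (j : nat) (a : rat) (b : nat -> rat) : a != 0 ->
  size (a *: \prod_(s < j) ('X - (b s)%:P)) = j.+1 /\
  lead_coef (a *: \prod_(s < j) ('X - (b s)%:P)) = a.
Proof.
move=> a0; rewrite -(big_mkord xpredT (fun s => 'X - (b s)%:P)).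
split; first by rewrite size_scale // size_prod_XsubC size_iota subn0.
by rewrite lead_coefZ (monicP (monic_prod_XsubC _ _ _)) mulr1.
Qed.

Lemma fact_prod_pairs j :
  (\prod_(i < j) ((j - i) * (j + i.+1)) = (j.*2)`!)%N.
Proof.
(* The pairs with i < k cover the integers from j - k + 1 to j + k; (j - k)! supplies the rest. *)
suff H k : (k <= j)%N -> (\prod_(i < k) ((j - i) * (j + i.+1)) * (j - k)`! =
  (j + k)`!)%N.
  by have := H j (leqnn j); rewrite subnn muln1 addnn.
elim: k => [|k IH] lekj; first by rewrite big_ord0 subn0 addn0 mul1n.
rewrite big_ord_recr /= addnS factS -IH ?(ltnW lekj) //.
by rewrite -(subnSK lekj) factS; ring.
Qed.

Lemma fact_prod_pairsS j :
  (j.+1 * \prod_(i < j) ((j - i) * (j + i.+2)) = (j.*2.+1)`!)%N.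
Proof.
suff H k : (k <= j)%N ->
    (j.+1 * \prod_(i < k) ((j - i) * (j + i.+2)) * (j - k)`! = (j + k).+1`!)%N.
  by have := H j (leqnn j); rewrite subnn muln1 addnn.
elim: k => [|k IH] lekj; first by rewrite big_ord0 subn0 addn0 muln1 factS.
rewrite big_ord_recr /= [(j + k.+1)%N]addnS factS -IH ?(ltnW lekj) //.
by rewrite -(subnSK lekj) factS; ring.
Qed.

Section Products.
Variables (m : nat) (x : int).

Definition Podd : {mpoly rat[m]} :=
  \prod_(i < m) \prod_(j < m | (i < j)%N)
    ((((j.+1)%:R - (i.+1)%:R) * ((j.+1)%:R + (i.+1)%:R - 1))^-1 *:
      (('X_j - 'X_i) * ((2 * x + 1)%:~R - 'X_i - 'X_j))).

Definition Peven : {mpoly rat[m]} :=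
  (\prod_(i < m) \prod_(j < m | (i < j)%N)
    ((((j.+1)%:R - (i.+1)%:R) * ((j.+1)%:R + (i.+1)%:R))^-1 *:
      (('X_j - 'X_i) * ((2 * x + 2)%:~R - 'X_i - 'X_j)))) *
  \prod_(i < m) ((i.+1)%:R^-1 *: ((x + 1)%:~R - 'X_i)).

Lemma prod_ltn_pairs (f : nat -> nat -> rat) :
  \prod_(i < m) \prod_(j < m | (i < j)%N) f i j =
  \prod_(j < m) \prod_(i < j) f i j.
Proof.
rewrite (exchange_big_dep xpredT) //=; apply: eq_bigr => j _.
by rewrite -(big_ord_widen_cond m xpredT (fun i => f i j)) // ltnW.
Qed.

(** The parities cross. Column j has degree j in z = k (2x + 1 - k), so the determinant is a
    Vandermonde product of the z_j - z_i = (k_j - k_i) (2x + 1 - k_i - k_j). The leading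
    coefficients 1 / (2j)! supply the denominators. *)
Lemma polydet_evenbase : polydet m (evenbase x) = Podd.
Proof.
rewrite (eq_polydet _ (evenbaseE x)) polydet_Vandermonde; last first.
  move=> j.
  by have [] := @size_monic_scale j _ (fun s =>
    (((x + 1) * x - s.+1%:R * s%:R)%:~R)) (_ : (j.*2)`!%:R^-1 != 0);
    rewrite // invr_eq0 pnatr_eq0 -lt0n fact_gt0.
rewrite /Podd.
under [in RHS]eq_bigr => i _ do rewrite scaler_prod.
rewrite scaler_prod; congr (_ *: _); last first.
  apply: eq_bigr => i _; apply: eq_bigr => j _.
  by rewrite !rmorphM !rmorphB /= !horner_algX !rmorph_int; ring.
rewrite (prod_ltn_pairs
  (fun i j => (((j.+1)%:R - (i.+1)%:R) * ((j.+1)%:R + (i.+1)%:R - 1))^-1)).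
apply: eq_bigr => j _.
rewrite (size_monic_scale _ (fun s => (((x + 1) * x - s.+1%:R * s%:R)%:~R))
  _).2; last first.
  by rewrite invr_eq0 pnatr_eq0 -lt0n fact_gt0.
rewrite -fact_prod_pairs natr_prod -prodfV; apply: eq_bigr => i _.
congr (_^-1); rewrite natrM natrB ?(ltnW (ltn_ord i)) // natrD.
by rewrite -[j.+1%:R]natr1 -[i.+1%:R]natr1; ring.
Qed.

(** The same argument with z = k (2x + 2 - k), once the factor x + 1 - k_i has been taken out of row
    i. *)
Lemma polydet_oddbase : polydet m (oddbase x) = Peven.
Proof.
pose b (j s : nat) : rat := ((x + 1) * (x + 1) - s.+1%:R * s.+1%:R)%:~R.
pose g j : {poly rat} := (j.*2.+1)`!%:R^-1 *: \prod_(s < j) ('X - (b j s)%:P).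
have fact_neq0 j : (j.*2.+1)`!%:R^-1 != 0 :> rat.
  by rewrite invr_eq0 pnatr_eq0 -lt0n fact_gt0.
have -> : polydet m (oddbase x) =
    \det (diag_mx (\row_i ((x + 1)%:~R - 'X_i)) *m
      polymx m (fun j : nat => g j \Po ('X * ((2 * x + 2)%:~R - 'X)))).
  congr (\det _); apply/matrixP => i j; rewrite mul_diag_mx !mxE oddbaseE
    rmorphM /=.
  by rewrite /upoly rmorphB /= horner_algX rmorph_int.
rewrite det_mulmx det_diag -[\det (polymx _ _)]/(polydet _ _)
  polydet_Vandermonde; last first.
  by move=> j; have [] := size_monic_scale j (b j) (fact_neq0 j).
rewrite /Peven.
under [in RHS]eq_bigr => i _ do rewrite scaler_prod.
rewrite !scaler_prod -scalerAl -!scalerAr scalerA mulrC.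
congr (_ *: (_ * _)); last first.
- by apply: eq_bigr => i _; rewrite mxE.
- apply: eq_bigr => i _; apply: eq_bigr => j _.
  by rewrite !rmorphM !rmorphB /= !horner_algX !rmorph_int; ring.
rewrite (prod_ltn_pairs
  (fun i j => (((j.+1)%:R - (i.+1)%:R) * ((j.+1)%:R + (i.+1)%:R))^-1)).
rewrite -big_split; apply: eq_bigr => j _ /=.
rewrite (size_monic_scale j (b j) (fact_neq0 j)).2.
rewrite -fact_prod_pairsS natrM invfM mulrC natr_prod -prodfV; congr (_ * _).
apply: eq_bigr => i _; congr (_^-1).
rewrite natrM natrB ?(ltnW (ltn_ord i)) // natrD.
by rewrite -[j.+1%:R]natr1 -[i.+2%:R]natr1 -[i.+1%:R]natr1; ring.
Qed.


(** The reflection is u_q -> - u_q, and [oddfac] is odd, so row [q] of the determinant is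
    negated. *)
Lemma reflect_Peven (q : 'I_m) :
  reflect_var q ((2 * x + 2)%:~R) Peven = - Peven.
Proof.
rewrite -polydet_oddbase [LHS]subst_polydet.
have -> : \matrix_(i, j) horner_alg (if i == q then ((2 * x + 2)%:~R)%:MP -
  'X_q else 'X_i) (oddbase x j)
  = diag_mx (\row_i (if i == q then -1 else 1)) *m polymx m (oddbase x).
  apply/matrixP => i j; rewrite mul_diag_mx !mxE.
  case: eqP => [->|_]; last by rewrite mul1r.
  rewrite mulN1r /oddbase !linearZ /= -mulrN; congr (_ * _).
  rewrite !(rmorph_oddfac (horner_alg _)) /= -oddfacN; congr (oddfac _ _).
  rewrite /upoly !rmorphB /= !horner_algX !rmorph_int.
  ring.
rewrite det_mulmx det_diag (bigD1 q) //= mxE eqxx big1 ?mulr1 ?mulN1r //.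
by move=> i /negbTE iq; rewrite mxE iq.
Qed.

End Products.

(** * Sums over interlacing rows *)

Definition irange (a b : int) : seq int :=
  if b < a then [::] else [seq a + i%:Z | i <- iota 0 (absz (b - a)%R).+1].

Lemma mem_irange a b l : (l \in irange a b) = (a <= l <= b).
Proof.
rewrite /irange; case: ltP => ab; first by rewrite in_nil; lia.
apply/mapP/idP => [[i]|lab]; first by rewrite mem_iota; lia.
by exists `|l - a|%N; rewrite ?mem_iota; lia.
Qed.

Lemma irange_uniq a b : uniq (irange a b).
Proof.
rewrite /irange; case: ifP => // _; rewrite map_inj_uniq ?iota_uniq //.
by move=> i j; lia.
Qed.

Lemma irange_empty a b : b < a -> irange a b = [::].
Proof. by rewrite /irange => ->. Qed.

Lemma irange_rcons a b : a <= b -> irange a b = rcons (irange a (b - 1)) b.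
Proof.
rewrite /irange => ab; have -> : (b < a) = false by lia.
case: ltP => [lt|le].
  by have -> : a = b by [lia]; rewrite subrr /= addr0.
have -> : (absz (b - a)%R).+1 = ((absz (b - 1 - a)%R).+1 + 1)%N by lia.
rewrite iotaD map_cat /= cats1; congr (_ :: rcons _ _); lia.
Qed.

Lemma sum_irange_telescope (V : zmodType) (f : int -> V) a b : a <= b ->
  \sum_(l <- irange a (b - 1)) (f (l + 1) - f l) = f b - f a.
Proof.
move=> ab; have [n ->] : exists n : nat, b = a + n%:Z by exists `|b - a|%N; lia.
elim: n => [|n IH]; first by rewrite addr0 irange_empty ?big_nil ?subrr //; lia.
rewrite irange_rcons; last by lia.
have -> : a + n.+1%:Z - 1 = a + n%:Z by lia.
rewrite -cats1 big_cat big_seq1 /= IH.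
have -> : a + n%:Z + 1 = a + n.+1%:Z by lia.
by rewrite addrC subrKA.
Qed.

(* [interlacing a [:: k2; ...; km]] lists the strictly increasing
   [l1 < ... < l(m-1)] with [a <= l1 <= k2 <= l2 <= ... <= km]. *)
Fixpoint interlacing (a : int) (ks : seq int) : seq (seq int) :=
  if ks is k :: r then
    [seq l :: t | l <- irange a k, t <- interlacing (Num.max k (l + 1)) r]
  else [:: [::]].

(** Functions of lists, rather than polynomials, let the recursion freeze the first argument. *)
Fixpoint diffs (B : seq int -> rat) (s : seq int) : rat :=
  if s is l :: t then diffs (fun u => B (l + 1 :: u) - B (l :: u)) t
  else B [::].

Definition corners (a : int) (ks : seq int) (B : seq int -> rat) : rat :=
  \sum_(t < (size ks).+1)
    (-1) ^+ t * B (take t (a :: ks) ++ [seq k + 1 | k <- drop t ks]).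

Lemma corners_cons a k r B :
  corners a (k :: r) B =
  B [seq l + 1 | l <- k :: r] - corners k r (fun u => B (a :: u)).
Proof.
rewrite /corners big_ord_recl expr0 mul1r /= -sumrN; congr (_ + _).
by apply: eq_bigr => t _; rewrite exprS mulN1r mulNr.
Qed.

Lemma cornersB a ks B C :
  corners a ks (fun u => B u - C u) = corners a ks B - corners a ks C.
Proof. by rewrite /corners -sumrB; apply: eq_bigr => t _; rewrite mulrBr. Qed.

Definition adjacent_null m (B : seq int -> rat) :=
  forall p k s, (size p + (size s).+2)%N = m ->
    B (p ++ [:: k, k & s]) - B (p ++ [:: k, k + 1 & s])
      + B (p ++ [:: k + 1, k + 1 & s]) = 0.

Lemma adjacent_null_cons m B l :
  adjacent_null m.+1 B -> adjacent_null m (fun u => B (l :: u)).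
Proof. by move=> H p k s sz; apply: (H (l :: p)); rewrite /= addSn sz. Qed.

Lemma adjacent_nullB m B C :
  adjacent_null m B -> adjacent_null m C -> adjacent_null m
    (fun u => B u - C u).
Proof.
move=> HB HC p k s sz.
by rewrite -[RHS](HB p k s sz) -[RHS]subr0 -[in RHS](HC p k s sz); ring.
Qed.

(* Weak increase, where the last step may even decrease by one: then the range
   of the last summation is empty. *)
Fixpoint summable (a : int) (ks : seq int) : bool :=
  match ks with
  | [::] => true
  | [:: k] => a <= k + 1
  | k :: r => (a <= k) && summable (k + 1) r
  end.

Lemma summable_cons a k r :
  summable a (k :: r) =
  (if r is [::] then a <= k + 1 else a <= k) && summable (k + 1) r.
Proof. by case: r => [|? ?] //=; rewrite andbT. Qed.

Lemma summable_le a b ks : b <= a -> summable a ks -> summable b ks.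
Proof. by move=> ba; case: ks => [//|k [|k' r]] /=; lia. Qed.

(** The contributions at l = k: the first summand is the upper end of the telescoped sum over l < k,
    the second is the term l = k, where strictness moves the next lower bound to k + 1. *)
Lemma corners_diag k r B : adjacent_null (size r).+1 B ->
  corners k r (fun u => B (k :: u)) + corners (k + 1) r
    (fun u => B (k + 1 :: u) - B (k :: u)) =
  B [seq l + 1 | l <- k :: r].
Proof.
case: r => [|k' r] HB.
  by rewrite /corners /= !big_ord1 !expr0 !mul1r /= addrC subrK.
rewrite !corners_cons cornersB /=.
(* Termwise this is the relation of [adjacent_null] for the front pair (k, k). *)
suff : corners k' r (fun u => B [:: k, k & u]) - corners k' r
  (fun u => B [:: k, k + 1 & u])
   + corners k' r (fun u => B [:: k + 1, k + 1 & u]) = 0.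
  move=> H; rewrite -[RHS]subr0 -[in RHS]H; ring.
rewrite -cornersB /corners -big_split /= big1 // => t _.
rewrite -mulrDr (HB [::]) ?mulr0 //=.
rewrite size_cat size_map size_drop size_take /= ltnS -ltnS ltn_ord.
by have := ltn_ord t; lia.
Qed.

Lemma sum_interlacing_diffs a ks B :
  summable a ks -> adjacent_null (size ks) B ->
  \sum_(s <- interlacing a ks) diffs B s = corners a ks B.
Proof.
elim: ks a B => [|k r IH] a B.
  by rewrite /corners big_seq1 big_ord1 /= expr0 mul1r.
rewrite summable_cons => /andP[ak sumr] HB.
have HBl l : adjacent_null (size r) (fun u => B (l + 1 :: u) - B (l :: u)).
  by apply: adjacent_nullB; apply: adjacent_null_cons.
rewrite /= big_allpairs_dep /=.
have [le|lt] := leP a k; last first.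
  (* The one permitted descent: the sum is empty, and the two corner terms, [B] at k + 1 and [B] at
     a, cancel. *)
  have [r0 ->] : r = [::] /\ a = k + 1 by case: r {IH sumr HB HBl} ak => *;
    split => //; lia.
  rewrite irange_empty ?big_nil; last by lia.
  by rewrite r0 corners_cons /corners /= !big_ord1 /= expr0 !mul1r subrr.
(* For l < k the next lower bound is k and the sum over l telescopes; l = k is treated apart. *)
rewrite irange_rcons // -cats1 big_cat big_seq1 /=.
rewrite (eq_big_seq (fun l => corners k r (fun u => B (l + 1 :: u)) - corners k r (fun u => B (l :: u)))); last first.
  move=> l; rewrite mem_irange => lk.
  have -> : Num.max k (l + 1) = k by lia.
  rewrite -cornersB IH //; apply: summable_le sumr; lia.
rewrite (sum_irange_telescope (fun l => corners k r (fun u => B (l :: u)))) //.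
have -> : Num.max k (k + 1) = k + 1 by lia.
rewrite IH // addrAC corners_diag // corners_cons //.
Qed.

Lemma interlacingP a ks s :
  reflect [/\ size s = size ks, sorted <%R s,
      (forall j, (j < size ks)%N -> s`_j <= ks`_j) &
      (forall j, (j < size ks)%N -> (a :: ks)`_j <= s`_j)]
    (s \in interlacing a ks).
Proof.
elim: ks a s => [|k r IH] a s /=.
  by rewrite inE; apply: (iffP eqP) => [->|[/size0nil]].
apply: (iffP allpairsPdep) => [[l [t [+ /IH [szt st t_le t_ge] ->]]]|].
  rewrite mem_irange => /andP[al lk]; split => [|||].
  - by rewrite /= szt.
  - case: t szt st t_ge {t_le} => [//|y t] szt st t_ge /=; apply/andP; split=>
      //.
    by have := t_ge 0%N; rewrite -szt /= => /(_ isT); lia.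
  - by case=> [|j] //= /t_le.
  - case=> [//|j] /= jr; have := t_ge j jr; case: j {jr} => [|j] //=; lia.
case: s => [|l t] []; first by [].
move=> /= [szt] st t_le t_ge; exists l, t; split => //.
  by rewrite mem_irange (t_ge 0%N) // (t_le 0%N).
apply/IH; split => // [|j jr|j jr].
- exact: path_sorted st.
- exact: (t_le j.+1).
- have := t_ge j.+1 jr; case: j jr => [|j] //= jr.
  case: t szt st {t_le t_ge} => [|y t]; first by case: r jr {IH}.
  by move=> _ /= /andP[ly _]; lia.
Qed.

Lemma interlacing_uniq a ks : uniq (interlacing a ks).
Proof.
elim: ks a => [//|k r IH] a /=; apply: allpairs_uniq_dep => [|l _|]; rewrite
  ?irange_uniq //.
by move=> [l s] [l' s'] _ _ /= [-> ->].
Qed.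

(* The rows that can sit on top of the bottom row [ks] of an array with [n]
   rows. *)
Definition rows_above n (x : int) (ks : seq int) : seq (seq int) :=
  if ks is k :: r then interlacing k (if odd n then r else rcons r x)
  else [:: [::]].

Lemma rows_above_uniq n (x : int) ks : uniq (rows_above n x ks).
Proof. by case: ks => [|k r] //=; apply: interlacing_uniq. Qed.

(** With an odd number of rows every upper entry lies between two bottom entries. With an even
    number the last upper entry has only the upper bound [x], which acts as one more bottom
    entry. *)
Lemma rows_aboveP n (x : int) ks s : size ks = uphalf n.+1 -> all (<= x) ks ->
  reflect [/\ size s = uphalf n, sorted <%R s,
      (forall j, (j < uphalf n)%N -> ks`_j <= s`_j),
      (forall j, (j < uphalf n)%N -> (j.+1 < uphalf n.+1)%N -> s`_j <=
        ks`_j.+1) &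
      (forall j, (j < uphalf n)%N -> s`_j <= x)]
    (s \in rows_above n.+1 x ks).
Proof.
case: ks => [//|k r] szr /= /andP[kx /allP rx].
have r_le j : (j < size r)%N -> r`_j <= x by move=> jr; apply/rx/mem_nth.
case: szr => szr; case: ifPn => odd_n.
  have <- : size r = uphalf n by move: (uphalf_half n) odd_n szr; case: (odd n)
    => //=; lia.
  apply: (iffP (interlacingP _ _ _)) =>
    [[szs st s_le s_ge]|[szs st s_ge s_le sx]].
    by split=> // j jr; [move=> _; apply: s_le | apply: le_trans (s_le j jr)
      (r_le j jr)].
  by split=> // j jr; apply: s_le => //; rewrite ltnS -szr.
have szr' : (size r).+1 = uphalf n by move: (uphalf_half n) odd_n szr; case:
  (odd n) => //=; lia.
rewrite -szr'; apply: (iffP (interlacingP _ _ _)); rewrite size_rcons.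
  move=> [szs st s_le s_ge]; split=> // j jr.
  - by have := s_ge j jr; case: j jr => [|j] //=; rewrite ltnS nth_rcons => ->.
  - by rewrite ltnS -szr => jr'; have := s_le j jr; rewrite nth_rcons jr'.
  - apply: le_trans (s_le j jr) _; rewrite nth_rcons; case: ltnP =>
      [/r_le //|le].
    by rewrite eqn_leq le -ltnS jr.
move=> [szs st s_ge s_le sx]; split=> // j jr.
  rewrite nth_rcons; case: ltnP => [jr'|jr']; first by apply: s_le; rewrite
    ?ltnS -?szr.
  by rewrite eqn_leq jr' -ltnS jr sx.
by have := s_ge j jr; case: j jr => [|j] //=; rewrite ltnS nth_rcons => ->.
Qed.

(* The lists of rows [n - 1, ..., 0] above the bottom row [ks] of an array with
   [n] rows, including the empty row [0]. *)
Fixpoint triangles n (x : int) ks : seq (seq (seq int)) :=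
  if n is n'.+1 then
    [seq s :: t | s <- rows_above n x ks, t <- triangles n' x s]
  else [:: [::]].

Lemma triangles_uniq n x ks : uniq (triangles n x ks).
Proof.
elim: n ks => [//|n IH] ks /=; apply: allpairs_uniq_dep => [|s _|]; rewrite
  ?rows_above_uniq //.
by move=> [s t] [s' t'] _ _ /= [-> ->].
Qed.

(** * Arrays and their lists of rows *)

Section Arrays.
Implicit Types (g : nat -> nat -> int).

(** Rows are numbered from 1 here; row 0 is empty. *)
Definition arow g i := mkseq (g i) (uphalf i).

Fixpoint arows g n := if n is n'.+1 then arow g n' :: arows g n' else [::].

Lemma nth_arow g i j : (j < uphalf i)%N -> (arow g i)`_j = g i j.
Proof. exact: nth_mkseq. Qed.

Lemma eq_arow g g' i : (forall j, (j < uphalf i)%N -> g i j = g' i j) -> arow g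
  i = arow g' i.
Proof.
move=> gg'; apply/eq_in_map => j; rewrite mem_iota => /gg' //.
Qed.

Lemma eq_arows g g' n :
  (forall i, (i < n)%N -> arow g i = arow g' i) -> arows g n = arows g' n.
Proof.
elim: n => [//|n IH] gg' /=; rewrite gg' // IH // => i lti.
by apply: gg'; apply: ltnW.
Qed.

Lemma arows_inj g g' n : arows g n = arows g' n ->
  forall i, (i < n)%N -> arow g i = arow g' i.
Proof.
elim: n => [//|n IH] /= [eq_n eq_r] i; rewrite ltnS leq_eqVlt =>
  /predU1P[-> //|].
exact: IH.
Qed.

Lemma mem_triangles_arows n x g :
  reflect (forall i, (i < n)%N -> arow g i \in rows_above i.+1 x (arow g i.+1))
    (arows g n \in triangles n x (arow g n)).
Proof.
elim: n => [|n IH]; first by apply: (iffP idP).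
apply: (iffP allpairsPdep) => [[s [t [s_in /= t_in [s_def t_def]]]]|H].
  move: s_in t_in; rewrite -s_def -t_def => s_in /IH H i.
  by rewrite ltnS leq_eqVlt => /predU1P[-> //|]; apply: H.
exists (arow g n), (arows g n); split=> //; first exact: H.
by apply/IH => i lti; apply/H/ltnW.
Qed.

Lemma trianglesP n (x : int) ks t : size ks = uphalf n -> all (<= x) ks ->
  t \in triangles n x ks -> exists2 g, arow g n = ks & arows g n = t.
Proof.
elim: n ks t => [|n IH] ks t szk kx.
  rewrite inE => /eqP->; exists (fun _ _ => 0) => //.
  by rewrite (size0nil szk).
move=> /allpairsPdep[s [t' [/(rows_aboveP _ szk kx)[szs _ _ _ sx] t'_in ->]]].
have [|g gn gt] := IH s t' szs _ t'_in.
  by apply/(all_nthP 0) => j; rewrite szs; apply: sx.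
exists (fun i => if i == n.+1 then nth 0 ks else g i).
  by rewrite /arow eqxx -szk mkseq_nth.
have eq_g i : (i <= n)%N -> arow (fun i => if i == n.+1 then nth 0 ks else g i)
  i = arow g i.
  by move=> lei; rewrite /arow ifN //; lia.
by rewrite /= eq_g // gn -gt; congr (_ :: _); apply: eq_arows => i /ltnW;
  apply: eq_g.
Qed.

End Arrays.

Section GammaTris.
Variable n : nat.
Implicit Types (a : {ffun hmt_index n -> int}) (u : hmt_index n).

(** The row number exceeds [hmt_row] by one, to agree with [arow]; outside the triangle the value is
    0. *)
Definition entry a i j : int :=
  if [pick u | ((hmt_row u).+1 == i) && (hmt_col u == j :> nat)] is Some u then
    a u else 0.

Lemma entry_hmt a u : entry a (hmt_row u).+1 (hmt_col u) = a u.
Proof.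
rewrite /entry; case: pickP => [v /andP[/eqP[eq_r] /eqP eq_c]|/(_ u)]; last by
  rewrite !eqxx.
congr (a _); apply: val_inj; case: v u eq_r eq_c => -[i j] ? [[i' j'] ?] /=.
by rewrite /hmt_row /hmt_col /= => eq_i eq_j; congr (_, _); apply: val_inj.
Qed.

Lemma hmt_index_ex i j : (i < n)%N -> (j < uphalf i.+1)%N ->
  exists u, hmt_row u = i :> nat /\ hmt_col u = j :> nat.
Proof.
move=> lti ltj; have ltj' : (j < uphalf n)%N by lia.
by exists (@exist _ (fun ij : 'I_n * 'I_(uphalf n) => (ij.2 < uphalf ij.1.+1)%N)
    (Ordinal lti, Ordinal ltj') ltj).
Qed.

Lemma hmt_col_lt u : (hmt_col u < uphalf (hmt_row u).+1)%N.
Proof. exact: (valP u). Qed.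

Variables (x : int) (k : 'I_(uphalf n) -> int).
Hypothesis k_incr : forall i j : 'I_(uphalf n), (i < j)%N -> k i < k j.
Hypothesis k_le_x : forall i : 'I_(uphalf n), k i <= x.
Let ks := [seq k i | i <- enum 'I_(uphalf n)].

Lemma size_ks : size ks = uphalf n.
Proof. by rewrite size_map size_enum_ord. Qed.

Lemma nth_ks (i : 'I_(uphalf n)) : ks`_i = k i.
Proof. by rewrite (nth_map i) ?nth_ord_enum // size_enum_ord. Qed.

Lemma ks_le_x : all (<= x) ks.
Proof. by apply/allP => _ /mapP[i _ ->]; apply: k_le_x. Qed.

Lemma ks_sorted : sorted <%R ks.
Proof.
apply/(sortedP 0) => i; rewrite size_ks => lti.
have lti' := ltnW lti.
by rewrite (nth_ks (Ordinal lti')) (nth_ks (Ordinal lti)) k_incr.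
Qed.

Lemma hmt_row_entry a : hmt_set x k a -> arow (entry a) n = ks.
Proof.
case=> _ a_bot _; apply: (@eq_from_nth _ 0); rewrite size_mkseq ?size_ks // =>
  j ltj.
have n_gt0 : (0 < n)%N by lia.
have [||u [ur uc]] := @hmt_index_ex n.-1 j; rewrite ?prednK //.
rewrite nth_arow // -{1}(prednK n_gt0) -ur -uc entry_hmt a_bot ?ur ?prednK //.
by rewrite nth_ks.
Qed.

Lemma rows_entry_in a : hmt_set x k a -> arows (entry a) n \in triangles n x ks.
Proof.
move=> aS; have [a_hmt _ a_x] := aS; rewrite -(hmt_row_entry aS).
have hmt_entry i j : (0 < i <= n)%N -> (j < uphalf i)%N ->
    exists u, [/\ (hmt_row u).+1 = i, hmt_col u = j :> nat &
      (arow (entry a) i)`_j = a u].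
  case: i => [//|i] lti ltj; have [u [ur uc]] := hmt_index_ex lti ltj.
  by exists u; split; rewrite ?ur // -ur -uc nth_arow ?entry_hmt ?hmt_col_lt.
apply/mem_triangles_arows => i lti.
have sz j : size (arow (entry a) j) = uphalf j by rewrite size_mkseq.
apply/rows_aboveP; rewrite ?sz //.
  apply/(all_nthP 0) => j; rewrite sz => ltj.
  have [||u [_ _ ->]] := hmt_entry i.+1 j; [by rewrite lti | by [] | exact:
    a_x].
split=> // [|j ltj|j ltj ltj'|j ltj].
- apply/(sortedP 0) => j; rewrite sz => ltj.
  have [||u [ur uc ->]] := hmt_entry i j; [lia|lia|].
  have [||v [vr vc ->]] := hmt_entry i j.+1; [lia|lia|].
  by have [_ _] := a_hmt u v; apply; lia.
- have [||u [ur uc ->]] := hmt_entry i j; [lia|lia|].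
  have [||v [vr vc ->]] := hmt_entry i.+1 j; [lia|lia|].
  by have [+ _ _] := a_hmt u v; apply; lia.
- have [||u [ur uc ->]] := hmt_entry i j; [lia|lia|].
  have [||v [vr vc ->]] := hmt_entry i.+1 j.+1; [lia|lia|].
  by have [_ + _] := a_hmt u v; apply; lia.
- by have [||u [ur uc ->]] := hmt_entry i j; [lia|lia|apply: a_x].
Qed.

Lemma rows_entry_inj a b : hmt_set x k a -> hmt_set x k b ->
  arows (entry a) n = arows (entry b) n -> a = b.
Proof.
move=> aS bS /arows_inj eq_ab; apply/ffunP => u.
have eq_row_ab : arow (entry a) (hmt_row u).+1 = arow (entry b) (hmt_row u).+1.
  have := ltn_ord (hmt_row u); rewrite leq_eqVlt => /predU1P[->|/eq_ab //].
  by rewrite !hmt_row_entry.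
by rewrite -!entry_hmt -!(nth_arow _ (hmt_col_lt u)) eq_row_ab.
Qed.

Lemma tris_rows_entry t : (0 < n)%N -> t \in triangles n x ks ->
  exists2 a, hmt_set x k a & arows (entry a) n = t.
Proof.
move=> n_gt0 t_in; have [g g_n g_t] := trianglesP size_ks ks_le_x t_in.
have g_tris i : (i < n)%N -> arow g i \in rows_above i.+1 x (arow g i.+1).
  by move: i; apply/mem_triangles_arows; rewrite g_n g_t.
have sz i : size (arow g i) = uphalf i by rewrite size_mkseq.
(* Induction upwards from the bottom row: applying [rows_aboveP] to row i presupposes the bound on
   row i + 1. *)
have g_x i : (i <= n)%N -> all (<= x) (arow g i).
  have [d] := ubnP (n - i); elim: d i => // d IH i ltd.
  rewrite leq_eqVlt => /predU1P[->|lti]; first by rewrite g_n ks_le_x.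
  have /rows_aboveP[||_ _ _ _ le_x] := g_tris i lti;
    [by rewrite sz | by apply: IH; lia |].
  by apply/(all_nthP 0) => j; rewrite sz; apply: le_x.
have g_above i (lti : (i < n)%N) := elimT (rows_aboveP (arow g i) (sz i.+1)
  (g_x _ lti)) (g_tris i lti).
have g_sorted i : (i <= n)%N -> sorted <%R (arow g i).
  rewrite leq_eqVlt => /predU1P[->|/g_above[] //]; by rewrite g_n ks_sorted.
pose a := [ffun u : hmt_index n => g (hmt_row u).+1 (hmt_col u)].
have entry_a i : (0 < i <= n)%N -> arow (entry a) i = arow g i.
  case: i => [//|i] lti; apply: eq_arow => j ltj.
  have [u [ur uc]] := hmt_index_ex lti ltj.
  by rewrite -ur -uc entry_hmt ffunE.
exists a.
  have aE u : a u = (arow g (hmt_row u).+1)`_(hmt_col u) by rewrite ffunE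
    nth_arow ?hmt_col_lt.
  split=> [u v|u ur|u].
  - rewrite !aE; split=> vr vc.
    + rewrite vr vc; have [|_ _ + _ _] := @g_above (hmt_row u).+1; first by
        rewrite -vr ltn_ord.
      by apply; rewrite hmt_col_lt.
    + rewrite vr vc; have [|_ _ _ + _] := @g_above (hmt_row u).+1; first by
        rewrite -vr ltn_ord.
      by apply; rewrite ?hmt_col_lt // -vc -vr hmt_col_lt.
    + rewrite vr vc; have /(sortedP 0) := g_sorted _ (ltn_ord (hmt_row u));
        apply.
      by rewrite sz -vc -vr hmt_col_lt.
  - by rewrite aE ur g_n nth_ks.
  - rewrite aE; have /(all_nthP 0) := g_x _ (ltn_ord (hmt_row u)); apply.
    by rewrite sz hmt_col_lt.
rewrite -g_t; apply: eq_arows => i lti.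
have [->|i_gt0] := posnP i; first by rewrite /arow.
by apply: entry_a; rewrite i_gt0 ltnW.
Qed.

(** With the bottom row given, a triangle and the list of its other rows determine each other. *)
Lemma gamma_triangles : (0 < n)%N -> gamma x k = size (triangles n x ks).
Proof.
move=> n_gt0; rewrite /gamma; set S := fset_set _.
have inS a : (a \in S) = (a \in hmt_set x k) by rewrite in_fset_set //; apply:
  finite_hmt_set.
rewrite -(size_map (fun a => arows (entry a) n)); apply/perm_size/uniq_perm.
- rewrite map_inj_in_uniq ?fset_uniq // => a b.
  by rewrite !inS !inE => aS bS; apply: rows_entry_inj.
- exact: triangles_uniq.
- move=> t; apply/mapP/idP => [[a]|/(tris_rows_entry n_gt0)[a aS <-]].
    by rewrite inS inE => aS ->; apply: rows_entry_in.
  by exists a; rewrite // inS inE.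
Qed.


End GammaTris.

(** * The recursion *)

Section EvalSeq.
Variable m : nat.
Implicit Types (P : {mpoly rat[m]}) (s t u p : seq int) (i j : 'I_m).

Definition evals P s : rat := P.@[fun i : 'I_m => (s`_i)%:~R].

Lemma evals_E P i p l u : i = size p :> nat ->
  evals (E i P) (p ++ l :: u) = evals P (p ++ l + 1 :: u).
Proof.
move=> ip; rewrite /evals E_subst subst_eval; apply: meval_eq => j.
rewrite mevalD mevalXU mevalC !nth_cat -ip.
case: ltngtP => [ji|ij|ji].
- by rewrite ifN ?addr0 // -val_eqE /= ltn_eqF.
- by rewrite ifN ?addr0 -?val_eqE ?gtn_eqF // -[(j - i)%N]prednK ?subn_gt0.
by rewrite -val_eqE /= ji eqxx subnn /= rmorphD.
Qed.

Lemma evals_Delta P i p l u : i = size p :> nat ->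
  evals (Delta i P) (p ++ l :: u) =
  evals P (p ++ l + 1 :: u) - evals P (p ++ l :: u).
Proof. by move=> ip; rewrite -(evals_E _ _ _ ip) /evals -mevalB. Qed.

Lemma Delta_comm P i j : Delta i (Delta j P) = Delta j (Delta i P).
Proof. by rewrite -!shift_opXB1 shift_op_comm. Qed.

Lemma foldr_Delta_comm P i (r : seq 'I_m) :
  foldr (@Delta m) (Delta i P) r = Delta i (foldr (@Delta m) P r).
Proof. by elim: r => //= j r ->; rewrite Delta_comm. Qed.

Lemma eq_diffs (B C : seq int -> rat) s : B =1 C -> diffs B s = diffs C s.
Proof.
by elim: s B C => [|l s IH] B C BC /=; [apply: BC | apply: IH => u; rewrite
  !BC].
Qed.

Lemma diffs_evals P s : size s = m ->
  diffs (evals P) s = evals (foldr (@Delta m) P (enum 'I_m)) s.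
Proof.
(* The prefix [p] holds the arguments already differenced; [diffs] and the tail of the enumeration
   advance together. *)
suff H p t : (size p + size t)%N = m ->
    diffs (fun u => evals P (p ++ u)) t =
    evals (foldr (@Delta m) P (drop (size p) (enum 'I_m))) (p ++ t).
  by move=> szs; have := H [::] s szs; rewrite drop0 => <-.
elim: t p P => [|l t IH] p P /=; first by rewrite addn0 => szp; rewrite
  drop_oversize ?size_enum_ord ?szp.
move=> szp; have ltp : (size p < m)%N by rewrite -szp addnS ltnS leq_addr.
rewrite (drop_nth (Ordinal ltp)) ?size_enum_ord //= -foldr_Delta_comm.
rewrite (nth_ord_enum _ (Ordinal ltp)) -cat_rcons -(size_rcons p l).
rewrite -IH ?size_rcons ?addSnnS //; apply: eq_diffs => u.
by rewrite cat_rcons evals_Delta.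
Qed.

Lemma foldr_Delta_factors P (r : seq 'I_m) :
  foldr (@Delta m) (factors P) r = factors (foldr (@Delta m) P r).
Proof. by elim: r => //= i r ->; rewrite -!shift_opXB1 factors_shift_op. Qed.

Lemma adjacent_null_factors P :
  (forall i j, j = i.+1 :> nat -> psubst (tperm i j) P = - P) ->
  adjacent_null m (evals (factors P)).
Proof.
move=> anti p k s szs; have lti : (size p < m)%N by lia.
have ltj : ((size p).+1 < m)%N by lia.
pose i := Ordinal lti; pose j := Ordinal ltj.
pose v (q : 'I_m) : rat := ((p ++ [:: k, k & s])`_q)%:~R.
have vij : v i = v j by rewrite /v !nth_cat /= ltnn subnn ltnNge leqnSn /=
  subSnn.
have /= := factors_adjacent (erefl : j = i.+1 :> nat) (anti i j erefl) vij.
rewrite -[(factors P).@[v]]/(evals _ _) -[(E j _).@[v]]/(evals _ _)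
  -[(E i _).@[v]]/(evals _ _).
have E_j l : evals (E j (factors P)) (p ++ [:: l, k & s]) = evals (factors P)
  (p ++ [:: l, k + 1 & s]).
  by rewrite -!(cat_rcons l p) evals_E // size_rcons.
by rewrite (@evals_E _ i) // !E_j.
Qed.

End EvalSeq.

Lemma psubst_polydetZ m (a : rat) c (i j : 'I_m) : j = i.+1 :> nat ->
  psubst (tperm i j) (a *: polydet m c) = - (a *: polydet m c).
Proof.
move=> ij; rewrite linearZ /= psubst_polydet ?scalerN //.
by rewrite -val_eqE /= ij ltn_eqF.
Qed.

Lemma size_triangles n (x : int) ks :
  size (triangles n.+1 x ks) = (\sum_(s <- rows_above n.+1 x ks) size
    (triangles n x s))%N.
Proof. by rewrite size_allpairs_dep sumnE big_map. Qed.

Lemma summable_path a r : path <%R a r -> summable (a + 1) r.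
Proof.
elim: r a => [//|k r IH] a /andP[ak /IH sum_r]; rewrite summable_cons sum_r
  andbT.
by case: r {IH sum_r} => [|? ?]; lia.
Qed.

Lemma summable_path_rcons a r (x : int) :
  path <%R a r -> all (<= x) (a :: r) -> summable (a + 1) (rcons r x).
Proof.
elim: r a => [|k r IH] a; first by rewrite /= andbT; lia.
move=> /andP[ak kr] /andP[ax krx]; rewrite rcons_cons summable_cons IH // andbT.
by case: r {IH kr krx} => [|? ?] /=; lia.
Qed.

Section Recursion.
Variable x : int.

(** The reflection k -> 2x + 2 - k of the last variable fixes x + 1, commutes with [factors] and
    negates [Peven], so the value is its own negative. *)
Lemma evals_Peven_null m s : s`_m = x + 1 ->
  evals (factors (Peven m.+1 x)) s = 0.
Proof.
move=> s_m; set G := factors _; set v := fun i : 'I_m.+1 => (s`_i)%:~R : rat.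
have max_m (p : 'I_m.+1) : (p <= @ord_max m)%N by rewrite -ltnS.
have := factors_reflect ((2 * x + 2)%:~R) max_m (Peven m.+1 x).
rewrite reflect_Peven linearN /= -/G => /(congr1 (meval v)).
rewrite mevalN subst_eval (@meval_eq _ _ _ v) => [|p]; last first.
  case: eqP => [->|_]; rewrite ?mevalXU // mevalB mevalC mevalXU /v /= s_m.
  by rewrite !(rmorphD, rmorphM) /=; ring.
move=> /eqP; rewrite eq_sym -addr_eq0 -mulr2n mulrn_eq0 => /eqP; exact.
Qed.

Definition count_even m := forall ks, size ks = m -> sorted <%R ks -> all
  (<= x) ks ->
  (size (triangles m.*2 x ks))%:R = evals (factors (Peven m x)) ks.

Definition count_odd m := forall ks, size ks = m.+1 -> sorted <%R ks -> all
  (<= x) ks ->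
  (size (triangles m.*2.+1 x ks))%:R = evals (factors (Podd m.+1 x)) ks.

Lemma count_odd_step m : count_even m -> count_odd m.
Proof.
move=> even_m [//|k r] [szr] r_sorted r_x.
(* The argument 'X - 1 turns the forward difference of [c j] into the backward one of
   [evenbase x j.+1], which is [oddbase x j]; thus [Q] is an antidifference of [Peven]. *)
pose c j := evenbase x j.+1 \Po ('X - 1).
pose Q := polydet m c.
have DQ : foldr (@Delta m) (factors Q) (enum 'I_m) = factors (Peven m x).
  rewrite foldr_Delta_factors Delta_polydet -polydet_oddbase; congr (factors _).
  apply: eq_polydet => j; rewrite /c -comp_polyA.
  rewrite comp_polyB comp_polyX -[1 in X in _ - X]polyC1 comp_polyC polyC1
    addrK comp_polyXr.
  exact: diff_evenbase.
rewrite size_triangles natr_sum.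
rewrite (eq_big_seq (diffs (evals (factors Q)))) => [|s s_in]; last first.
  have /rows_aboveP[||szs s_sorted _ _ s_x] := s_in; rewrite ?uphalf_double //=.
    by rewrite szr doubleK.
  rewrite even_m ?szs ?uphalf_double // ?diffs_evals ?DQ ?szs ?uphalf_double //.
  by apply/(all_nthP 0) => j; rewrite szs; apply: s_x.
rewrite /= odd_double /= sum_interlacing_diffs; last first.
- rewrite szr; apply: adjacent_null_factors => i j ij.
  by rewrite -[Q]scale1r psubst_polydetZ.
- by apply: summable_le (summable_path r_sorted); lia.
(* Expanding along the column [evenbase x 0 = 1] matches term t with corner t. *)
rewrite -polydet_evenbase polydet_omit ?evenbase0 // [in RHS]linear_sum /=
  [RHS]/evals [RHS]raddf_sum /=.
rewrite /corners szr; apply: eq_bigr => t _.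
rewrite linearZ /= mevalZ; congr (_ * _).
(* By [factors_omit] exactly the arguments after the omitted one are raised by 1, as in corner t. *)
rewrite -shift_op_prodX_polydet factors_omit shift_op_prodX -/c -/Q.
rewrite !subst_eval /evals; apply: meval_eq => q.
rewrite mevalD !mevalXU rmorph_nat nth_cat size_take /= szr ltn_ord /bump.
case: ltnP => [qt|tq]; first by rewrite nth_take // addr0.
rewrite (nth_map 0) ?nth_drop ?subnKC //=; first by rewrite rmorphD.
by rewrite size_drop szr ltn_sub2r // (leq_ltn_trans tq).
Qed.

Lemma count_even_step m : count_odd m -> count_even m.+1.
Proof.
move=> odd_m [//|k r] [szr] r_sorted r_x.
(* Each of the m + 1 forward differences of [oddbase] brings a sign, which (-1)^(m + 1)
   compensates. *)
pose B := factors ((-1) ^+ m.+1 *: Peven m.+1 x).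
have DB : foldr (@Delta m.+1) B (enum 'I_m.+1) = factors (Podd m.+1 x).
  rewrite foldr_Delta_factors; congr (factors _).
  rewrite -polydet_oddbase -polydet_evenbase.
  rewrite -[X in (-1) ^+ X](card_ord m.+1) -prodr_const
    -(polydetZ _ (fun=> -1)) Delta_polydet.
  apply: eq_polydet => j; rewrite comp_polyZ !scaleN1r opprK addrC -opprB.
  by rewrite diff_oddbase opprK.
rewrite doubleS size_triangles natr_sum.
rewrite (eq_big_seq (diffs (evals B))) => [|s s_in]; last first.
  have /rows_aboveP[||szs s_sorted _ _ s_x] := s_in; rewrite //=.
    by rewrite szr; lia.
  rewrite odd_m ?szs /= ?doubleK ?uphalf_double // ?diffs_evals ?DB ?szs /=
    ?doubleK ?uphalf_double //.
  by apply/(all_nthP 0) => j; rewrite szs; apply: s_x.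
rewrite /= odd_double /= sum_interlacing_diffs; last first.
- rewrite size_rcons szr; apply: adjacent_null_factors => i j ij.
  by rewrite -polydet_oddbase psubst_polydetZ.
- by apply: summable_le (summable_path_rcons r_sorted r_x); lia.
have evB s : evals B s = (-1) ^+ m.+1 * evals (factors (Peven m.+1 x)) s.
  by rewrite /B linearZ /= /evals mevalZ.
(* In every corner but the last the final argument is x + 1, where [B] vanishes. The last corner is
   the bottom row itself, and its sign cancels the one in [B]. *)
rewrite /corners size_rcons szr big_ord_recr big1 /= => [|t _].
  rewrite add0r evB mulrA -exprMn mulrNN mulr1 expr1n mul1r drop_oversize
    ?size_rcons ?szr // cats0.
  by rewrite -cats1 take_size_cat.
have ltt : (t < m.+1)%N by [].
have szt : size (take t (k :: rcons r x)) = t.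
  by rewrite size_takel //= size_rcons szr (leq_trans (ltnW ltt)).
rewrite evB evals_Peven_null ?mulr0 // nth_cat szt ltnNge -ltnS ltt /=.
rewrite (nth_map 0) ?size_drop ?size_rcons ?szr ?ltn_sub2r //.
by rewrite nth_drop subnKC // nth_rcons szr ltnn eqxx.
Qed.

Lemma count_evenP m : count_even m.
Proof.
elim: m => [|m IH]; last exact/count_even_step/count_odd_step.
move=> ks /size0nil-> _ _ /=.
have -> : Peven 0 x = 1 by rewrite /Peven !big_ord0 mulr1.
rewrite (@factors_unique _ _ 1) ?/evals ?meval1 //.
by rewrite /factors_den /factors_num !big_pred0 // => -[[]].
Qed.

Lemma count_oddP m : count_odd m.
Proof. exact/count_odd_step/count_evenP. Qed.

End Recursion.

Theorem theorem2 (n : nat) (x : int) (k : 'I_(uphalf n) -> int)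
    (n_ge1 : (1 <= n)%N)
    (k_incr : forall i j : 'I_(uphalf n), (i < j)%N -> k i < k j)
    (k_le_x : forall i : 'I_(uphalf n), k i <= x) :
  (odd n ->
    (gamma x k)%:R =
    (factors
      (\prod_(i < uphalf n) \prod_(j < uphalf n | (i < j)%N)
         ((((j.+1)%:R - (i.+1)%:R) * ((j.+1)%:R + (i.+1)%:R - 1))^-1 *:
          (('X_j - 'X_i) * ((2 * x + 1)%:~R - 'X_i - 'X_j))))
    ).@[fun i => (k i)%:~R] :> rat) /\
  (~~ odd n ->
    (gamma x k)%:R =
    (factors
      ((\prod_(i < uphalf n) \prod_(j < uphalf n | (i < j)%N)
          ((((j.+1)%:R - (i.+1)%:R) * ((j.+1)%:R + (i.+1)%:R))^-1 *:
           (('X_j - 'X_i) * ((2 * x + 2)%:~R - 'X_i - 'X_j)))) *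
       \prod_(i < uphalf n) ((i.+1)%:R^-1 *: ((x + 1)%:~R - 'X_i)))
    ).@[fun i => (k i)%:~R] :> rat).
Proof.
rewrite (gamma_triangles k_incr k_le_x n_ge1); set ks := [seq k i | i <- _].
have evals_ks P : P.@[fun i => (k i)%:~R] = evals P ks.
  by apply: meval_eq => i; rewrite nth_ks.
rewrite !evals_ks -/(Podd _ _) -/(Peven _ _) {evals_ks}.
have : [/\ size ks = uphalf n, sorted <%R ks & all (<= x) ks].
  by split; [apply: size_ks | apply: ks_sorted | apply: ks_le_x].
clearbody ks; move: ks => {k k_incr k_le_x} ks [szk sk xk]; have nE :=
  odd_double_half n.
split=> odd_n; move: nE szk; rewrite ?odd_n ?(negbTE odd_n) => <-.
  by rewrite /= doubleK => szk; apply: count_oddP.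
by rewrite add0n uphalf_double => szk; apply: count_evenP.
Qed.
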